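(* Let $(\bar M,\bar f,\bar g)$ be a weak nearly Kähler manifold and let $M^{2n+s}\subset\bar M$ be a submanifold of codimension $s$ equipped with mutually orthogonal unit normals $N_1,\dots,N_s$ satisfying $\bar g(\bar fN_i,N_j)=0$ for $1\le i,j\le s$. Let $(f,Q,\xi_i,\eta^i,g)$ be the induced weak metric $f$-structure on $M$, given by $$\xi_i=\bar fN_i,\quad \eta^i=\bar g(\bar fN_i,\cdot)\quad(1\le i\le s),\quad g=\bar g|_M,$$ $$f=\bar f+\sum_{i=1}^s\bar g(\bar fN_i,\cdot)\,N_i,\quad Q=-\bar f^{\,2}+\sum_{i=1}^s\bar g(\bar f^{\,2}N_i,\cdot)\,N_i.$$ Let $h$ be the second fundamental form of $M$ and $h_{N_i}(X,Y)=\bar g(h(X,Y),N_i)$, and suppose that $$h_{N_i}(\xi_j,\xi_k)=h_{N_j}(\xi_i,\xi_k)\qquad(1\le i,j,k\le s).$$ (i) If for all $1\le i\le s$ and $X,Y\in\mathfrak X_M$ $$h_{N_i}(X,Y)=g(QX,Y)+\sum_{j,k=1}^s\big(h_{N_i}(\xi_j,\xi_k)-\delta_{j,k}\big)\,\eta^j(X)\,\eta^k(Y),$$ then $(f,Q,\xi_i,\eta^i,g)$ is a weak nearly $\mathcal S$-structure. (ii) If for all $1\le i\le s$ and $X,Y\in\mathfrak X_M$ $$h_{N_i}(X,Y)=\sum_{j,k=1}^sh_{N_i}(\xi_j,\xi_k)\,\eta^j(X)\,\eta^k(Y),$$ then $(f,Q,\xi_i,\eta^i,g)$ is a weak nearly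 $\mathcal C$-structure.
   Context: All objects are smooth; $\mathfrak X_M$ is the set of vector fields on $M$. A weak Hermitian manifold $(\bar M,\bar f,\bar g)$ is a Riemannian manifold $(\bar M,\bar g)$ of even dimension equipped with a skew-symmetric $(1,1)$-tensor $\bar f$ such that $\bar f^{\,2}$ is negative-definite; it is called weak nearly Kähler if $(\overline\nabla_X\bar f)Y+(\overline\nabla_Y\bar f)X=0$ for all vector fields $X,Y$, where $\overline\nabla$ is the Levi-Civita connection of $\bar g$. The second fundamental form $h$ of $M\subset\bar M$ is defined by $\overline\nabla_XY=\nabla_XY+h(X,Y)$ for $X,Y\in\mathfrak X_M$, where $\nabla$ is the Levi-Civita connection of the induced metric $g$. A weak metric $f$-structure on a manifold $M^{2n+s}$ ($n,s>0$) is a set $(f,Q,\xi_i,\eta^i,g)$ ($1\le i\le s$), where $g$ is a Riemannian metric, $f$ is a $(1,1)$-tensor of rank $2n$, skew-symmetric with respect to $g$, $Q$ is a self-adjoint nonsingular $(1,1)$-tensor, $\xi_i$ are orthonormal vector fields, and $\eta^i$ are dual 1-forms, satisfying $$f^2=-Q+\sum_{i=1}^s\eta^i\otimes\xi_i,\quad \eta^i(\xi_j)=\delta^i_j,\quad Q\xi_i=\xi_i,\quad g(fX,fY)=g(X,QY)-\sum_{i=1}^s\eta^i(X)\eta^i(Y).$$ The paper asserts, in a lemma preceding this theorem, that a codimension $s$ submanifold $M^{2n+s}$ of a weak Hermitian manifold with mutually orthogonal unit normals satisfying $\bar g(\bar fN_i,N_j)=0$ inherits a weak metric $f$-structure given by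 the formulas in the claim; this is the induced structure meant there. Put $\bar\eta=\sum_{i=1}^s\eta^i$ and $\bar\xi=\sum_{i=1}^s\xi_i$. A weak metric $f$-structure is a weak nearly $\mathcal S$-structure if $$(\nabla_Xf)Y+(\nabla_Yf)X=2\,g(fX,fY)\,\bar\xi+\bar\eta(X)f^2Y+\bar\eta(Y)f^2X\quad (X,Y\in\mathfrak X_M),$$ and a weak nearly $\mathcal C$-structure if $(\nabla_Xf)Y+(\nabla_Yf)X=0$ for all $X,Y\in\mathfrak X_M$.
   Formalization: It is assumed that the tuple given by the displayed formulas is a weak metric f-structure; this is not automatic: in flat ℝ⁴ with constant f̄, f̄² = −diag(4,4,1,1), N = e₁, the field ξ = f̄N on the hyperplane x₁ = 0 has length 2 and Qξ = 4ξ. *)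

(* Defs.v *)
From mathcomp Require Import all_boot all_order all_algebra.
From mathcomp Require Import all_classical all_reals all_analysis.

Set Implicit Arguments.
Unset Strict Implicit.
Unset Printing Implicit Defensive.

Import Order.TTheory GRing.Theory Num.Theory.
Import numFieldNormedType.Exports.

Local Open Scope classical_set_scope.
Local Open Scope ring_scope.

Section Manifolds.
Context {R : realType}.

Fixpoint Cn {m : nat} (k : nat) (U : set 'rV[R]_m) (f : 'rV[R]_m -> R) : Prop :=
  match k with
  | 0 => forall x, U x -> {for x, continuous f}
  | k'.+1 => (forall x, U x -> differentiable f x) /\
             (forall v : 'rV[R]_m, Cn k' U ('D_v f))
  end.

(* Used only with U open. *)
Definition Cinfty {m : nat} (U : set 'rV[R]_m) (f : 'rV[R]_m -> R) : Prop :=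
  forall k, Cn k U f.

(* A homeomorphism from the open set cdom onto the open set ccod; cmap and
   cinv are total functions whose values outside these sets are irrelevant. *)
Record chart (T : topologicalType) (m : nat) := Chart {
  cdom : set T;
  ccod : set 'rV[R]_m;
  cmap : T -> 'rV[R]_m;
  cinv : 'rV[R]_m -> T;
  open_cdom : open cdom;
  open_ccod : open ccod;
  cmapP : forall q, cdom q -> ccod (cmap q);
  cinvP : forall x, ccod x -> cdom (cinv x);
  cmapK : forall q, cdom q -> cinv (cmap q) = q;
  cinvK : forall x, ccod x -> cmap (cinv x) = x;
  cmap_continuous : forall q, cdom q -> {for q, continuous cmap};
  cinv_continuous : forall x, ccod x -> {for x, continuous cinv} }.

(* The atlas is indexed by the points of the manifold, chart_at p being a chart
   around p; every smooth structure is generated by such an atlas. *)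
Record manifold (m : nat) := Manifold {
  carrier :> topologicalType;
  manifold_hausdorff : hausdorff_space carrier;
  manifold_second_countable : @second_countable carrier;
  chart_at : carrier -> chart carrier m;
  chart_at_dom : forall p, cdom (chart_at p) p;
  chart_at_compat : forall p q (k : 'I_m),
    Cinfty [set x | ccod (chart_at p) x /\
                    cdom (chart_at q) (cinv (chart_at p) x)]
           (fun x => cmap (chart_at q) (cinv (chart_at p) x) 0 k) }.

(* The tangent space at p is modelled as 'rV[R]_m: a row u stands for the tangent
   vector with components u in the chart chart_at p.  Accordingly a (1,1)-tensor
   is a family f p : 'M[R]_m with f(u) = u *m f p, a 1-form is a family
   a p : 'cV[R]_m, and a (0,2)-tensor is a family of Gram matrices. *)

Definition inner {m : nat} (g : 'M[R]_m) (u v : 'rV[R]_m) : R :=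
  (u *m g *m v^T) 0 0.

Definition eval_1form {m : nat} (a : 'cV[R]_m) (u : 'rV[R]_m) : R := (u *m a) 0 0.

(* Smoothness on an open subset U of the manifold. *)
Definition smooth_on {m : nat} {M : manifold m} (U : set M) (phi : M -> R) :=
  forall p : M, Cinfty [set x | ccod (chart_at p) x /\ U (cinv (chart_at p) x)]
                       (fun x => phi (cinv (chart_at p) x)).

Definition smooth {m : nat} {M : manifold m} (phi : M -> R) := smooth_on setT phi.

(* The differential of phi at p, applied to u in T_pM; phi only needs to be
   meaningful near p. *)
Definition dfun {m : nat} {M : manifold m} (phi : M -> R) (p : M)
    (u : 'rV[R]_m) : R :=
  'D_u (fun x => phi (cinv (chart_at p) x)) (cmap (chart_at p) p).

Definition coord {m : nat} {M : manifold m} (c : M) (k : 'I_m) (q : M) : R :=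
  cmap (chart_at c) q 0 k.

Definition smooth_map {m k : nat} {M : manifold m} {N : manifold k} (F : M -> N) :=
  continuous F /\
  forall (c : N) (j : 'I_k),
    smooth_on [set q | cdom (chart_at c) (F q)] (fun q => coord c j (F q)).

Definition tmap {m k : nat} {M : manifold m} {N : manifold k} (F : M -> N) (p : M)
    (u : 'rV[R]_m) : 'rV[R]_k :=
  \row_j dfun (fun q => coord (F p) j (F q)) p u.

(* V is a smooth vector field along F, i.e. a smooth section of F^* TN: its
   components in each chart of N are smooth. *)
Definition vfield_along {m k : nat} {M : manifold m} {N : manifold k} (F : M -> N)
    (V : M -> 'rV[R]_k) :=
  forall (c : N) (j : 'I_k),
    smooth_on [set q | cdom (chart_at c) (F q)]
              (fun q => dfun (coord c j) (F q) (V q)).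

Definition vfield {m : nat} (M : manifold m) (X : M -> 'rV[R]_m) :=
  @vfield_along m m M M (fun p => p) X.

Definition smooth_tensor11 {m : nat} (M : manifold m) (f : M -> 'M[R]_m) :=
  forall X, vfield X -> @vfield m M (fun p => X p *m f p).

Definition smooth_1form {m : nat} (M : manifold m) (a : M -> 'cV[R]_m) :=
  forall X, vfield X -> smooth (fun p : M => eval_1form (a p) (X p)).

Definition riemannian_metric {m : nat} (M : manifold m) (g : M -> 'M[R]_m) :=
  [/\ forall p, (g p)^T = g p,
      forall p u, u != 0 -> 0 < inner (g p) u u &
      forall X Y, vfield X -> vfield Y -> smooth (fun p : M => inner (g p) (X p) (Y p))].

(* D X V is the derivative of the vector field V along F in the direction of the
   vector field X on M; D is unconstrained on non-smooth arguments. *)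
Definition connection_along {m k : nat} (M : manifold m) (N : manifold k)
    (F : M -> N) (D : (M -> 'rV[R]_m) -> (M -> 'rV[R]_k) -> M -> 'rV[R]_k) :=
  [/\ forall X V, vfield X -> vfield_along F V -> vfield_along F (D X V),
      forall X Y V, vfield X -> vfield Y -> vfield_along F V ->
        forall p, D (fun q => X q + Y q) V p = D X V p + D Y V p,
      forall phi X V, smooth phi -> vfield X -> vfield_along F V ->
        forall p, D (fun q => phi q *: X q) V p = phi p *: D X V p,
      forall X V W, vfield X -> vfield_along F V -> vfield_along F W ->
        forall p, D X (fun q => V q + W q) p = D X V p + D X W p &
      forall phi X V, smooth phi -> vfield X -> vfield_along F V ->
        forall p, D X (fun q => phi q *: V q) p
                  = dfun phi p (X p) *: V p + phi p *: D X V p].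

Definition affine_connection {m : nat} (M : manifold m)
    (nabla : (M -> 'rV[R]_m) -> (M -> 'rV[R]_m) -> M -> 'rV[R]_m) :=
  @connection_along m m M M (fun p => p) nabla.

(* Torsion-freeness is nabla_X Y - nabla_Y X = [X, Y], the bracket being given by
   its action on functions. *)
Definition levi_civita {m : nat} (M : manifold m) (g : M -> 'M[R]_m)
    (nabla : (M -> 'rV[R]_m) -> (M -> 'rV[R]_m) -> M -> 'rV[R]_m) :=
  [/\ affine_connection nabla,
      forall X Y phi, vfield X -> vfield Y -> smooth phi ->
        forall p, dfun phi p (nabla X Y p - nabla Y X p)
                  = dfun (fun q => dfun phi q (Y q)) p (X p)
                    - dfun (fun q => dfun phi q (X q)) p (Y p) &
      forall X Y Z, vfield X -> vfield Y -> vfield Z ->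
        forall p, dfun (fun q => inner (g q) (Y q) (Z q)) p (X p)
                  = inner (g p) (nabla X Y p) (Z p)
                    + inner (g p) (Y p) (nabla X Z p)].

(* D is the pullback connection of nablaN on vector fields along F: the last
   clause and the Leibniz rule determine it.  This is what nablaN_X V means for X
   tangent to a submanifold and V a vector field along it. *)
Definition induced_connection {m k : nat} (M : manifold m) (N : manifold k)
    (F : M -> N)
    (nablaN : (N -> 'rV[R]_k) -> (N -> 'rV[R]_k) -> N -> 'rV[R]_k)
    (D : (M -> 'rV[R]_m) -> (M -> 'rV[R]_k) -> M -> 'rV[R]_k) :=
  connection_along F D /\
  forall X W Z p, vfield X -> vfield W -> vfield Z ->
    W (F p) = tmap F p (X p) ->
    D X (fun q => Z (F q)) p = nablaN W Z (F p).

(* (nabla_X f) Y *)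
Definition cov_tensor11 {m : nat} (M : manifold m)
    (nabla : (M -> 'rV[R]_m) -> (M -> 'rV[R]_m) -> M -> 'rV[R]_m)
    (f : M -> 'M[R]_m) (X Y : M -> 'rV[R]_m) (p : M) : 'rV[R]_m :=
  nabla X (fun q => Y q *m f q) p - nabla X Y p *m f p.

Definition weak_hermitian {m : nat} (M : manifold m) (f g : M -> 'M[R]_m) :=
  [/\ ~~ odd m,
      riemannian_metric g,
      smooth_tensor11 f,
      forall p u v, inner (g p) (u *m f p) v = - inner (g p) u (v *m f p) &
      forall p u, u != 0 -> inner (g p) (u *m f p *m f p) u < 0].

Definition weak_nearly_kahler {m : nat} (M : manifold m) (f g : M -> 'M[R]_m)
    (nabla : (M -> 'rV[R]_m) -> (M -> 'rV[R]_m) -> M -> 'rV[R]_m) :=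
  [/\ weak_hermitian f g,
      levi_civita g nabla &
      forall X Y, vfield X -> vfield Y -> forall p,
        cov_tensor11 nabla f X Y p + cov_tensor11 nabla f Y X p = 0].

Record fstructure {m : nat} (M : manifold m) (s : nat) := FStructure {
  fs_f : M -> 'M[R]_m;
  fs_Q : M -> 'M[R]_m;
  fs_xi : 'I_s -> M -> 'rV[R]_m;
  fs_eta : 'I_s -> M -> 'cV[R]_m;
  fs_g : M -> 'M[R]_m }.

Definition weak_metric_f {n s : nat} (M : manifold (2 * n + s))
    (S : fstructure M s) : Prop :=
  let f := fs_f S in let Q := fs_Q S in let g := fs_g S in
  let xi := fs_xi S in let eta := fs_eta S in
  [/\ [/\ (0 < n)%N, (0 < s)%N & riemannian_metric g],
      [/\ smooth_tensor11 f,
          forall p, \rank (f p) = (2 * n)%N &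
          forall p u v, inner (g p) (u *m f p) v = - inner (g p) u (v *m f p)],
      [/\ smooth_tensor11 Q,
          forall p, Q p \in unitmx &
          forall p u v, inner (g p) (u *m Q p) v = inner (g p) u (v *m Q p)],
      [/\ forall i, vfield (xi i),
          forall i, smooth_1form (eta i) &
          forall p i j, inner (g p) (xi i p) (xi j p) = (i == j)%:R] &
      [/\ forall p u, u *m f p *m f p
                      = - (u *m Q p) + \sum_i eval_1form (eta i p) u *: xi i p,
          forall p i j, eval_1form (eta i p) (xi j p) = (i == j)%:R,
          forall p i, xi i p *m Q p = xi i p &
          forall p u v, inner (g p) (u *m f p) (v *m f p)
                        = inner (g p) u (v *m Q p)
                          - \sum_i eval_1form (eta i p) u * eval_1form (eta i p) v]].

Definition weak_nearly_S {n s : nat} (M : manifold (2 * n + s))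
    (S : fstructure M s)
    (nabla : (M -> 'rV[R]_(2 * n + s)) -> (M -> 'rV[R]_(2 * n + s)) ->
             M -> 'rV[R]_(2 * n + s)) : Prop :=
  let f := fs_f S in let g := fs_g S in
  let etabar p u := \sum_i eval_1form (fs_eta S i p) u in
  let xibar p := \sum_i fs_xi S i p in
  [/\ weak_metric_f S,
      levi_civita g nabla &
      forall X Y, vfield X -> vfield Y -> forall p,
        cov_tensor11 nabla f X Y p + cov_tensor11 nabla f Y X p
        = (2 * inner (g p) (X p *m f p) (Y p *m f p)) *: xibar p
          + etabar p (X p) *: (Y p *m f p *m f p)
          + etabar p (Y p) *: (X p *m f p *m f p)].

Definition weak_nearly_C {n s : nat} (M : manifold (2 * n + s))
    (S : fstructure M s)
    (nabla : (M -> 'rV[R]_(2 * n + s)) -> (M -> 'rV[R]_(2 * n + s)) ->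
             M -> 'rV[R]_(2 * n + s)) : Prop :=
  [/\ weak_metric_f S,
      levi_civita (fs_g S) nabla &
      forall X Y, vfield X -> vfield Y -> forall p,
        cov_tensor11 nabla (fs_f S) X Y p + cov_tensor11 nabla (fs_f S) Y X p = 0].

(* Only an injective immersion is required, so embedded submanifolds are a
   special case; T_pM is identified with its image under tmap iota p. *)
Definition submanifold {m k : nat} (M : manifold m) (Mb : manifold k)
    (iota : M -> Mb) :=
  [/\ smooth_map iota, injective iota &
      forall p u, tmap iota p u = 0 -> u = 0].

Definition orthonormal_normals {m k s : nat} (M : manifold m) (Mb : manifold k)
    (iota : M -> Mb) (gb : Mb -> 'M[R]_k) (N : 'I_s -> M -> 'rV[R]_k) :=
  [/\ forall i, vfield_along iota (N i),
      forall p i j, inner (gb (iota p)) (N i p) (N j p) = (i == j)%:R &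
      forall p i u, inner (gb (iota p)) (N i p) (tmap iota p u) = 0].

Definition induced_fstructure {m k s : nat} (M : manifold m) (Mb : manifold k)
    (iota : M -> Mb) (fb gb : Mb -> 'M[R]_k) (N : 'I_s -> M -> 'rV[R]_k)
    (S : fstructure M s) :=
  let d := tmap iota in
  let F p w := w *m fb (iota p) in
  let G p := inner (gb (iota p)) in
  [/\ forall p i, d p (fs_xi S i p) = F p (N i p),
      forall p i u, eval_1form (fs_eta S i p) u = G p (F p (N i p)) (d p u),
      forall p u v, inner (fs_g S p) u v = G p (d p u) (d p v),
      forall p u, d p (u *m fs_f S p)
        = F p (d p u) + \sum_i G p (F p (N i p)) (d p u) *: N i p &
      forall p u, d p (u *m fs_Q S p)
        = - F p (F p (d p u)) + \sum_i G p (F p (F p (N i p))) (d p u) *: N i p].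

Definition second_fundamental_form {m k : nat} (M : manifold m) (Mb : manifold k)
    (iota : M -> Mb)
    (nabla : (M -> 'rV[R]_m) -> (M -> 'rV[R]_m) -> M -> 'rV[R]_m)
    (D : (M -> 'rV[R]_m) -> (M -> 'rV[R]_k) -> M -> 'rV[R]_k)
    (X Y : M -> 'rV[R]_m) (p : M) : 'rV[R]_k :=
  D X (fun q => tmap iota q (Y q)) p - tmap iota p (nabla X Y p).

End Manifolds.

Arguments manifold : clear implicits.
Arguments chart : clear implicits.

(* Main.v *)
(* A connection along iota is C^infinity-linear up to the Leibniz rule, so the
   failure of "D is metric", of "D is torsion-free" and of "D_X commutes with fb"
   is tensorial in the field along iota; bump functions and chart frames reduce
   each of them, at a point, to the corresponding identity of nablab on global
   fields of the ambient manifold.  Koszul's argument then shows that the second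
   fundamental form h is symmetric and normal, and the Weingarten formula gives
     g((nabla_X f)Y + (nabla_Y f)X, Z)
       = sum_i (2 eta^i(Z) h_i(X,Y) - eta^i(Y) h_i(X,Z) - eta^i(X) h_i(Y,Z)).
   The coefficients h_i(xi_j, xi_k) are totally symmetric, so the cubic form they
   define cancels in this sum.  Nothing else remains in case (ii); in case (i)
   h_i(X,Y) = g(fX,fY) + cubic part, and the terms g(fX,fY) add up to the nearly
   S identity. *)

Require Import Defs.
From mathcomp Require Import all_boot all_order all_algebra.
From mathcomp Require Import all_classical all_reals all_analysis.
From mathcomp Require Import ring lra.

Set Implicit Arguments.
Unset Strict Implicit.
Unset Printing Implicit Defensive.

Import Order.TTheory GRing.Theory Num.Theory.
Import numFieldNormedType.Exports.

Local Open Scope classical_set_scope.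
Local Open Scope ring_scope.

(** * Smooth functions on row vectors *)

(** Write [g = f + (g - f)]. The second summand vanishes near [x], so it has the zero map as its
    differential there. *)
Lemma near_eq_differentiable (R : realType) (V W : normedModType R) (f g : V -> W) (x : V) :
  (\near x, f x = g x) -> differentiable f x -> differentiable g x.
Proof.
move=> fg df.
have -> : g = f + (g - f) by rewrite addrC subrK.
apply: differentiableD => //.
have h0 : \forall y \near x, (g - f) y = 0.
  by near=> y; rewrite fctE; apply/eqP; rewrite subr_eq0 eq_sym; apply/eqP; near: y.
move: (g - f) h0 => h h0.
have hx : h x = 0 by exact: nbhs_singleton h0.
have c0 : continuous (\0 : V -> W) by move=> ?; exact: cst_continuous.
have hs : h \o shift x = cst (h x) + (\0 : {linear V -> W}) +o_ 0 id.
  apply/eqaddoP => e e0.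
  have := h0; rewrite (near_shift 0 x) subr0 /= => h0'.
  apply: filterS h0' => y hy.
  by rewrite !fctE /= hx hy !add0r oppr0 normr0 mulr_ge0 ?normr_ge0 // ltW.
have hd := diff_unique c0 hs.
apply/diff_locallyP; rewrite hd; split => //.
Unshelve. all: by end_near. Qed.

Section Cn.
Context {R : realType} {m : nat}.
Implicit Types (U : set 'rV[R]_m) (f g : 'rV[R]_m -> R).

(** Equality near [x] passes to directional derivatives near [x], so the induction does not need [U]
    to be open. *)
Lemma Cn_near_eq k U f g :
  (forall x, U x -> \near x, f x = g x) -> Cn k U f -> Cn k U g.
Proof.
elim: k f g => [|k IH] f g fg /=.
  move=> fc x Ux; have := fc x Ux; rewrite /prop_for/continuous_at.
  rewrite -(nbhs_singleton (fg x Ux)); apply: cvg_trans.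
  exact: near_eq_cvg (fg x Ux).
case=> fd fD; split=> [x Ux|v].
  exact: near_eq_differentiable (fg x Ux) (fd x Ux).
apply: IH (fD v) => x Ux.
have := near_join (fg x Ux); apply: filterS => y.
exact: near_eq_derive.
Qed.

Lemma Cn_continuous k U f : Cn k U f -> forall x, U x -> {for x, continuous f}.
Proof.
case: k => [|k] //= [fd _] x Ux; exact/differentiable_continuous/fd.
Qed.

Lemma CnW k U f : Cn k.+1 U f -> Cn k U f.
Proof.
elim: k f => [|k IH] f; first by move=> h x Ux; exact: Cn_continuous h x Ux.
by case=> fd fD; split=> // v; apply: IH; exact: fD.
Qed.

Lemma Cn_sub k U V f : U `<=` V -> Cn k V f -> Cn k U f.
Proof.
move=> UV; elim: k f => [|k IH] f /=; first by move=> h x /UV; exact: h.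
by case=> fd fD; split=> [x /UV|v]; [exact: fd | exact/IH/fD].
Qed.

(** [Cn] constrains a total function point by point, which is why smoothness can be glued from any
    cover. *)
Lemma Cn_bigcup k I (U : I -> set 'rV[R]_m) V f :
  (forall x, V x -> exists i, U i x) -> (forall i, Cn k (U i) f) -> Cn k V f.
Proof.
move=> VU; elim: k f => [|k IH] f /= h.
  by move=> x /VU[i]; exact: h.
split=> [x /VU[i]|v]; first by case: (h i) => + _; apply.
by apply: IH => i; case: (h i).
Qed.

Lemma open_near_eq U f g : open U -> (forall x, U x -> f x = g x) ->
  forall x, U x -> \near x, f x = g x.
Proof.
by move=> oU fg x Ux; near=> y; apply: fg; near: y; exact: open_nbhs_nbhs.
Unshelve. all: by end_near. Qed.

Lemma Cn_eq k U f g : open U -> (forall x, U x -> f x = g x) ->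
  Cn k U f -> Cn k U g.
Proof. by move=> oU fg; apply/Cn_near_eq/open_near_eq. Qed.

Lemma Cn_cst k U (c : R) : Cn k U (fun=> c).
Proof.
elim: k c => [|k IH] c /=; first by move=> x _; exact: cst_continuous.
split=> [x _|v]; first exact: differentiable_cst.
by rewrite (_ : 'D_v _ = fun=> 0) //; apply/funext => x; exact: derive_cst.
Qed.

Lemma CnD k U f g : open U -> Cn k U f -> Cn k U g -> Cn k U (fun x => f x + g x).
Proof.
move=> oU; elim: k f g => [|k IH] f g /=.
  by move=> hf hg x Ux; apply: continuousD; [exact: hf|exact: hg].
case=> [fd fD] [gd gD]; split=> [x Ux|v].
  by apply: differentiableD; [exact: fd|exact: gd].
apply: Cn_eq oU _ (IH _ _ (fD v) (gD v)) => x Ux.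
by rewrite -deriveD //; apply: diff_derivable; [exact: fd|exact: gd].
Qed.

Lemma CnM k U f g : open U -> Cn k U f -> Cn k U g -> Cn k U (fun x => f x * g x).
Proof.
move=> oU; elim: k f g => [|k IH] f g hf hg.
  by move=> x Ux; apply: continuousM; [exact: hf|exact: hg].
have [[fd fD] [gd gD]] := (hf, hg); split=> [x Ux|v].
  by apply: differentiableM; [exact: fd|exact: gd].
have h := CnD oU (IH _ _ (CnW hf) (gD v)) (IH _ _ (CnW hg) (fD v)).
apply: Cn_eq oU _ h => x Ux.
by rewrite -deriveM //; apply: diff_derivable; [exact: fd|exact: gd].
Qed.

Lemma CnV k U f : open U -> (forall x, U x -> f x != 0) -> Cn k U f ->
  Cn k U (fun x => (f x)^-1).
Proof.
move=> oU f0; elim: k => [|k IH] hf.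
  by move=> x Ux; apply: continuousV; [exact: f0|exact: hf].
have [fd fD] := hf; split=> [x Ux|v].
  by apply: differentiableV; [exact: fd|exact: f0].
have hV := IH (CnW hf).
have h := CnM oU (CnM oU (Cn_cst k U (-1)) (CnM oU hV hV)) (fD v).
apply: Cn_eq oU _ h => x Ux.
rewrite deriveV; [|exact: f0|by apply: diff_derivable; exact: fd].
by rewrite mulN1r -expr2 exprVn.
Qed.

Lemma Cn_sum k U I (r : seq I) (f : I -> 'rV[R]_m -> R) : open U ->
  (forall i, Cn k U (f i)) -> Cn k U (fun x => \sum_(i <- r) f i x).
Proof.
move=> oU hf; elim: r => [|i r IH].
  by under eq_fun do rewrite big_nil; exact: Cn_cst.
by under eq_fun do rewrite big_cons; exact: CnD.
Qed.

Lemma Cn_coord k U (i : 'I_m) : Cn k U (fun x => x 0 i).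
Proof.
case: k => [|k]; first by move=> x _; exact: coord_continuous.
split=> [x _|v]; first exact: differentiable_coord.
rewrite (_ : 'D_v _ = fun=> v 0 i); first exact: Cn_cst.
apply/funext => x.
by have /matrixP/(_ 0 i) := derive_mx (@derivable_id _ _ x v); rewrite derive_id mxE.
Qed.

End Cn.

(** * Row-valued maps and the chain rule in coordinates *)

Lemma differentiable_row (R : realType) m k (G : 'rV[R]_m -> 'rV[R]_k) x :
  (forall j, differentiable (fun y => G y 0 j : R) x) -> differentiable G x.
Proof.
move=> Gd; rewrite (_ : G = \sum_j (fun y => G y 0 j *: delta_mx 0 j)).
  by apply: differentiable_sum => j; apply: differentiableZl; exact: Gd.
by apply/funext => y; rewrite fct_sumE [LHS]row_sum_delta.
Qed.

Lemma derive_row (R : realType) m k (G : 'rV[R]_m -> 'rV[R]_k) x u j :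
  differentiable G x -> 'D_u G x 0 j = 'D_u (fun y => G y 0 j : R) x.
Proof.
by move=> Gd; rewrite derive_mx ?mxE //; exact: diff_derivable.
Qed.

Lemma derive_sum_delta (R : realType) m (f : 'rV[R]_m -> R) x u :
  differentiable f x -> 'D_u f x = \sum_j u 0 j * 'D_(delta_mx 0 j) f x.
Proof.
move=> fd; rewrite deriveE // {1}(row_sum_delta u) linear_sum.
by apply: eq_bigr => j _; rewrite linearZ deriveE.
Qed.

Lemma differentiable_comp_row (R : realType) m k (G : 'rV[R]_m -> 'rV[R]_k) f x :
  (forall j, differentiable (fun y => G y 0 j : R) x) ->
  differentiable f (G x) -> differentiable (fun y => f (G y) : R) x.
Proof. by move=> /differentiable_row Gd fd; exact: differentiable_comp. Qed.

Lemma derive_comp_row (R : realType) m k (G : 'rV[R]_m -> 'rV[R]_k) f x u :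
  (forall j, differentiable (fun y => G y 0 j : R) x) -> differentiable f (G x) ->
  'D_u (fun y => f (G y) : R) x
  = \sum_j 'D_u (fun y => G y 0 j : R) x * 'D_(delta_mx 0 j) f (G x).
Proof.
move=> Gj fd; have Gd := differentiable_row Gj.
rewrite deriveE; last exact: differentiable_comp.
rewrite [LHS](congr1 (@^~ u) (diff_comp Gd fd)) /= -!deriveE //.
rewrite derive_sum_delta //.
by apply: eq_bigr => j _; rewrite derive_row.
Qed.

Lemma continuous_row (R : realType) (T : topologicalType) k (G : T -> 'rV[R]_k) x :
  (forall j, {for x, continuous (fun y => G y 0 j : R)}) -> {for x, continuous G}.
Proof.
move=> Gc; apply/cvgrPdist_le => /= e e0.
near=> y; rewrite /Num.Def.normr/= mx_normrE (bigmax_le _ (ltW e0))//= => -[i j] _.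
rewrite !mxE ord1 /=; move: j {i}; near: y; apply: filter_forall => j.
by have /cvgrPdist_le/(_ _ e0) := Gc j.
Unshelve. all: by end_near. Qed.

(** The chain rule writes a derivative of the composite as a sum of products. Their factors are of
    order [n] by induction, which is applied to the partial derivatives of [f]. *)
Lemma Cn_comp (R : realType) m k n (U : set 'rV[R]_m) (V : set 'rV[R]_k)
    (G : 'rV[R]_m -> 'rV[R]_k) f : open U ->
  (forall x, U x -> V (G x)) -> (forall j, Cn n U (fun x => G x 0 j)) ->
  Cn n V f -> Cn n U (fun x => f (G x)).
Proof.
move=> oU GV; elim: n f => [|n IH] f Gn fn.
  move=> x Ux; apply: (@continuous_comp _ _ _ G f); last exact/fn/GV.
  by apply: continuous_row => j; exact: Gn.
have Gd j x : U x -> differentiable (fun y => G y 0 j : R) x.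
  by case: (Gn j) => + _; apply.
have [fd fD] := fn; split=> [x Ux|v].
  by apply: differentiable_comp_row => // [j|]; [exact: Gd|exact/fd/GV].
have h : Cn n U (fun x => \sum_j
    'D_v (fun y => G y 0 j : R) x * 'D_(delta_mx 0 j) f (G x)).
  apply: Cn_sum => // j; apply: CnM => //; first by have [_] := Gn j; apply.
  by apply: (IH ('D_(delta_mx 0 j) f)) => [i|]; [exact: CnW|exact: fD].
apply: Cn_eq oU _ h => x Ux.
by rewrite -derive_comp_row // => [j|]; [exact: Gd|exact/fd/GV].
Qed.

(* These functions are smooth because their derivatives are linear combinations
   of functions of the same family. *)
Definition flat (R : realType) (k : nat) (t : R) : R :=
  if 0 < t then t^-1 ^+ k * expR (- t^-1) else 0.

Lemma flat_bound (R : realType) k (t : R) :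
  `|flat k t| <= (k.+2)`!%:R * t ^+ 2.
Proof.
rewrite /flat; case: ifPn => [t0|_]; last first.
  by rewrite normr0 mulr_ge0 ?ler0n ?sqr_ge0.
have s0 : 0 < t^-1 by rewrite invr_gt0.
rewrite ger0_norm; last by rewrite mulr_ge0 ?exprn_ge0 ?expR_ge0 ?ltW.
have t2 : 0 < t ^+ 2 by rewrite exprn_gt0.
rewrite -ler_pdivrMr // expRN ler_pdivrMr // ler_pdivrMr ?expR_gt0 // -mulrA.
rewrite -ler_pdivrMl ?ltr0n ?fact_gt0 // -ler_pdivrMl //.
have := expR_ge1Dxn k.+1 (ltW s0); apply: le_trans.
rewrite (_ : _ * _ = t^-1 ^+ k.+2 / (k.+2)`!%:R); first by rewrite lerDr.
rewrite !exprS expr0 mulr1 invfM; ring.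
Qed.

Lemma is_derive_flat (R : realType) k (t : R) :
  is_derive t 1 (flat k : R -> R) (- k%:R * flat k.+1 t + flat k.+2 t).
Proof.
have [t0|t0|->] := ltrgt0P t.
- have tn0 : t != 0 by rewrite gt_eqF.
  have dinv : is_derive t 1 (@GRing.inv R) (- t ^- 2).
    apply: DeriveDef; first by apply: derivableV => //; exact: derivable_id.
    by rewrite (deriveV tn0 (@derivable_id _ _ t 1)) derive_id /GRing.scale /= mulr1.
  have dE := @is_derive1_comp _ expR (- @GRing.inv R) t _ _
    (is_derive_expR (- t^-1)) (is_deriveN dinv).
  have h := is_deriveM (is_deriveX k dinv) dE.
  have fE : \forall u \near t, (GRing.inv ^+ k * (expR \o - GRing.inv)) u = flat k u.
    by near=> u; rewrite /flat ifT; [by rewrite /= !fctE|near: u; exact: lt_nbhsr].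
  apply: (is_derive_eq (near_eq_is_derive fE h)); rewrite /flat t0 !fctE /GRing.scale /= opprK.
  case: k {h fE} => [|k] /=; rewrite -!exprVn ?expr0.
    by rewrite mul0r mul0r mulr0 oppr0 mul0r add0r mul1r addr0 mulrC.
  by rewrite !exprS; ring.
- have h : is_derive t 1 (fun=> 0 : R) (- k%:R * flat k.+1 t + flat k.+2 t).
    rewrite /flat ltNge ltW //= mulr0 addr0; exact: is_derive_cst.
  apply: near_eq_is_derive h.
  near=> u; rewrite /flat ifF //; apply/negbTE; rewrite -leNgt ltW //.
  by near: u; exact: lt_nbhsl.
(* At the origin, [flat_bound] bounds the difference quotient by a constant times the absolute value
   of [h]. *)
have c : (fun h : R => h^-1 *: ((flat k \o shift 0) (h *: (1:R)) - flat k 0)) @ 0^' --> (0 : R).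
  apply/cvgr0Pnorm_le => e e0.
  near=> h.
  rewrite /= addr0 {2}/flat ltxx subr0 /GRing.scale /= mulr1 normrM normfV.
  rewrite ler_pdivrMl; last by rewrite normr_gt0; near: h; exact: nbhs_dnbhs_neq.
  apply: le_trans (flat_bound _ _) _.
  rewrite -(real_normK (num_real h)) expr2 mulrA mulrC ler_wpM2l //.
  rewrite -ler_pdivlMl ?ltr0n ?fact_gt0 //.
  near: h; apply: dnbhs0_le. by rewrite mulr_gt0 // invr_gt0 ltr0n fact_gt0.
rewrite /flat ltxx mulr0 addr0.
apply: DeriveDef; first by apply/cvg_ex; exists 0.
exact/cvg_lim.
Unshelve. all: by end_near. Qed.

(** The induction is uniform in [k], since differentiating [flat k] brings in [flat k.+1] and
    [flat k.+2]. *)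
Lemma Cn_flat (R : realType) m k n (U : set 'rV[R]_m) (G : 'rV[R]_m -> R) : open U ->
  Cn n U G -> Cn n U (fun x => flat k (G x)).
Proof.
move=> oU; have fd j t : differentiable (flat j : R -> R) t.
  by apply/derivable1_diffP; case: (is_derive_flat j t).
elim: n k => [|n IH] k hG.
  move=> x Ux; apply: (@continuous_comp _ _ _ G (flat k)); first exact: hG.
  exact: differentiable_continuous.
have [Gd GD] := hG; split=> [x Ux|v].
  by apply: differentiable_comp => //; exact: Gd.
have h : Cn n U (fun x => (- k%:R * flat k.+1 (G x) + flat k.+2 (G x)) * 'D_v G x).
  apply: CnM => //; last exact: GD.
  apply: CnD => //; last exact/IH/CnW.
  by apply: CnM => //; [exact: Cn_cst|exact/IH/CnW].
apply: Cn_eq oU _ h => x Ux.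
rewrite [RHS]deriveE; last by apply: differentiable_comp => //; exact: Gd.
rewrite [RHS](congr1 (@^~ v) (diff_comp (Gd x Ux) (fd k (G x)))) /=.
rewrite -[X in 'd (flat k) _ X]mulr1 linearZ /= -!deriveE //; last exact: Gd.
by have [_ ->] := is_derive_flat k (G x); rewrite mulrC.
Qed.

Lemma bump_row (R : realType) m (x0 : 'rV[R]_m) (O : set 'rV[R]_m) :
  open O -> O x0 ->
  exists b K, [/\ Cinfty setT b, b x0 = 1, compact K, K `<=` O &
                  forall x, ~ K x -> b x = 0].
Proof.
move=> oO Ox0.
have /nbhs_ballP[e /= e0 eO] : nbhs x0 O by exact: open_nbhs_nbhs.
pose r := e / 2; have r0 : 0 < r by rewrite divr_gt0.
(* [G] is [r ^+ 2] minus the squared Euclidean distance to [x0]. Where it is positive, every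
   coordinate differs by less than [r], so the support lies in the closed ball of the maximum
   norm. *)
pose G (x : 'rV[R]_m) := r ^+ 2 + \sum_i (- 1) * ((x 0 i - x0 0 i) * (x 0 i - x0 0 i)).
have Gx0 : G x0 = r ^+ 2.
  by rewrite /G big1 ?addr0 // => i _; rewrite subrr mul0r mulr0.
have b0 : flat 0 (G x0) != 0.
  by rewrite /flat Gx0 exprn_gt0 // expr0 mul1r gt_eqF ?expR_gt0.
exists (fun x => flat 0 (G x) * (flat 0 (G x0))^-1), (closed_ball x0 r); split.
- move=> k; apply: CnM; [exact: openT| |exact: Cn_cst].
  apply: Cn_flat; first exact: openT.
  apply: CnD; [exact: openT|exact: Cn_cst|].
  apply: Cn_sum => [|i]; first exact: openT.
  have cD : Cn k setT (fun x : 'rV[R]_m => x 0 i - x0 0 i).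
    by apply: CnD; [exact: openT|exact: Cn_coord|exact: Cn_cst].
  apply: CnM; [exact: openT|exact: Cn_cst|].
  by apply: CnM => //; exact: openT.
- by rewrite divff.
- apply: bounded_closed_compact; last exact: closed_ball_closed.
  rewrite closed_ballE //; exists (`|x0| + r); split; first exact: num_real.
  move=> M hM x /=; rewrite /closed_ball_ /= => hx.
  rewrite (le_trans _ (ltW hM)) // -[x](subKr x0) (le_trans (ler_normB _ _)) //.
  by rewrite lerD2l.
- apply: subset_trans eO; rewrite closed_ballE // => x /=.
  rewrite /closed_ball_ /= -ball_normE /= => /le_lt_trans; apply.
  by rewrite /r ltr_pdivrMr // ltr_pMr // ltr1n.
move=> x; rewrite closed_ballE // /closed_ball_ /= => xr.
rewrite /flat ifF ?mul0r //; apply/negP => G0; apply: xr.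
rewrite /Num.Def.normr/= mx_normrE (bigmax_le _ (ltW r0))//= => -[i j] _.
rewrite !mxE ord1 /= distrC -(ler_pXn2r (ltn0Sn 1)) ?nnegrE ?normr_ge0 ?(ltW r0) //.
rewrite real_normK ?num_real //; apply: ltW; rewrite -subr_gt0.
apply: lt_le_trans G0 _; rewrite /G lerD2l (bigD1 j) //= mulN1r -expr2 gerDl.
by apply: sumr_le0 => l _; rewrite mulN1r -expr2 oppr_le0 sqr_ge0.
Qed.

(** * Smooth functions on manifolds *)

Section SmoothFunctions.
Context {R : realType} {m : nat} {M : manifold R m}.
Implicit Types (U V : set M) (phi psi : M -> R) (p q : M).

Lemma open_in_chart p U :
  open U -> open [set x | ccod (chart_at p) x /\ U (cinv (chart_at p) x)].
Proof.
move=> oU; rewrite openE => x [cx Ux]; apply: filterI.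
  by apply: open_nbhs_nbhs; split => //; exact: open_ccod.
by apply: (cinv_continuous cx); exact: open_nbhs_nbhs.
Qed.

Lemma open_from_chart p (O : set 'rV[R]_m) :
  open O -> open [set q | cdom (chart_at p) q /\ O (cmap (chart_at p) q)].
Proof.
move=> oO; rewrite openE => q [dq Oq]; apply: filterI.
  by apply: open_nbhs_nbhs; split => //; exact: open_cdom.
by apply: (cmap_continuous dq); exact: open_nbhs_nbhs.
Qed.

Lemma smooth_on_sub U V phi : U `<=` V -> smooth_on V phi -> smooth_on U phi.
Proof.
by move=> UV h p k; apply: Cn_sub (h p k) => x [cx /UV]; split.
Qed.

Lemma smooth_on_bigcup I (U : I -> set M) V phi :
  (forall q, V q -> exists i, U i q) -> (forall i, smooth_on (U i) phi) ->
  smooth_on V phi.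
Proof.
move=> VU h p k; apply: Cn_bigcup (fun i => h i p k) => x [cx /VU[i]].
by exists i.
Qed.

Lemma smooth_on_eq U phi psi : open U -> (forall q, U q -> phi q = psi q) ->
  smooth_on U phi -> smooth_on U psi.
Proof.
move=> oU e h p k; apply: Cn_eq (h p k); first exact: open_in_chart.
by move=> x [_ /e].
Qed.

Lemma smooth_on_cst U (c : R) : smooth_on U (fun=> c : R).
Proof. by move=> p k; exact: Cn_cst. Qed.

Lemma smooth_onD U phi psi : open U -> smooth_on U phi -> smooth_on U psi ->
  smooth_on U (fun q => phi q + psi q).
Proof.
move=> oU hp hq p k; exact (CnD (open_in_chart oU) (hp p k) (hq p k)).
Qed.

Lemma smooth_onM U phi psi : open U -> smooth_on U phi -> smooth_on U psi ->
  smooth_on U (fun q => phi q * psi q).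
Proof.
move=> oU hp hq p k; exact (CnM (open_in_chart oU) (hp p k) (hq p k)).
Qed.

Lemma smooth_onV U phi : open U -> (forall q, U q -> phi q != 0) ->
  smooth_on U phi -> smooth_on U (fun q => (phi q)^-1).
Proof.
move=> oU p0 hp p k; refine (CnV (open_in_chart oU) _ (hp p k)).
by move=> x [_ /p0].
Qed.

Lemma smooth_on_sum U I (r : seq I) (phi : I -> M -> R) : open U ->
  (forall i, smooth_on U (phi i)) -> smooth_on U (fun q => \sum_(i <- r) phi i q).
Proof.
by move=> oU h p k; refine (Cn_sum _ (open_in_chart oU) (fun i => h i p k)).
Qed.

Lemma smooth_coord (c : M) j : smooth_on (cdom (chart_at c)) (Defs.coord c j).
Proof. by move=> p; exact: chart_at_compat. Qed.

Lemma smooth_on_comp_chart (c : M) (O : set 'rV[R]_m) f : open O -> Cinfty O f ->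
  smooth_on [set q | cdom (chart_at c) q /\ O (cmap (chart_at c) q)]
            (fun q => f (cmap (chart_at c) q)).
Proof.
move=> oO hf p k.
apply: (@Cn_comp _ _ _ _ _ O (fun x => cmap (chart_at c) (cinv (chart_at p) x)) f).
- exact/open_in_chart/open_from_chart.
- by move=> x [_ []].
- move=> j; apply: Cn_sub (@chart_at_compat _ _ M p c j k).
  by move=> x [cx [dx _]].
- exact: hf.
Qed.

Lemma smooth_on_differentiable (c : M) U phi q : cdom (chart_at c) q -> U q ->
  smooth_on U phi ->
  differentiable (fun x => phi (cinv (chart_at c) x)) (cmap (chart_at c) q).
Proof.
move=> dq Uq /(_ c 1%N) [+ _]; apply; split; first exact: cmapP.
by rewrite cmapK.
Qed.

Lemma smooth_on_continuous U phi q : open U -> U q -> smooth_on U phi ->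
  {for q, continuous phi}.
Proof.
move=> oU Uq hp; have dq := chart_at_dom q.
have c : {for q, continuous (fun y => phi (cinv (chart_at q) (cmap (chart_at q) y)))}.
  apply: (@continuous_comp _ _ _ (cmap (chart_at q)) (fun x => phi (cinv (chart_at q) x))).
    exact: cmap_continuous.
  exact/differentiable_continuous/(smooth_on_differentiable dq Uq hp).
move: c; rewrite /prop_for /continuous_at cmapK //; apply: cvg_trans.
apply: near_eq_cvg; near=> y; rewrite cmapK //; near: y.
by apply: open_nbhs_nbhs; split => //; exact: open_cdom.
Unshelve. all: by end_near. Qed.

(** Near [p], [phi] is the quotient of two smooth functions on the open set where [psi] is
    nonzero. *)
Lemma smooth_local phi :
  (forall p, exists psi, [/\ smooth psi, psi p != 0 & smooth (fun q => psi q * phi q)]) ->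
  smooth phi.
Proof.
move=> /choice[psi h].
apply: (@smooth_on_bigcup M (fun p => [set q | psi p q != 0])).
  by move=> q _; exists q; case: (h q).
move=> p; have [sp _ spp] := h p.
have oU : open [set q | psi p q != 0].
  apply: (@open_comp _ _ (psi p) [set x | x != 0]); last exact: open_neq.
  by move=> q _; apply: smooth_on_continuous sp => //; exact: openT.
apply: (@smooth_on_eq _ (fun q => (psi p q)^-1 * (psi p q * phi q))) => //.
  by move=> q /= q0; rewrite mulrA mulVf ?mul1r.
apply: smooth_onM => //; last exact: smooth_on_sub spp.
by apply: smooth_onV => //; exact: smooth_on_sub sp.
Qed.

Lemma dfun_sum_delta U phi p u : U p -> smooth_on U phi ->
  dfun phi p u = \sum_j u 0 j * dfun phi p (delta_mx 0 j).
Proof.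
by move=> Up hp; apply/derive_sum_delta/(smooth_on_differentiable (chart_at_dom p) Up hp).
Qed.

Lemma dfunDr U phi p u v : U p -> smooth_on U phi ->
  dfun phi p (u + v) = dfun phi p u + dfun phi p v.
Proof.
move=> Up hp; rewrite !(dfun_sum_delta _ Up hp) -big_split /=.
by apply: eq_bigr => j _; rewrite mxE mulrDl.
Qed.

Lemma dfunZr U phi p a u : U p -> smooth_on U phi ->
  dfun phi p (a *: u) = a * dfun phi p u.
Proof.
move=> Up hp; rewrite !(dfun_sum_delta _ Up hp) mulr_sumr.
by apply: eq_bigr => j _; rewrite mxE mulrA.
Qed.

Lemma dfun_cst (c : R) p u : dfun (fun=> c : R) p u = 0.
Proof. exact: derive_cst. Qed.

Lemma dfun_eq U phi psi p u : open U -> U p -> (forall q, U q -> phi q = psi q) ->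
  dfun phi p u = dfun psi p u.
Proof.
move=> oU Up e; apply: near_eq_derive.
apply: (open_near_eq (open_in_chart (p := p) oU)) => [x [_ /e]|] //=.
by split; [exact/cmapP/chart_at_dom|rewrite cmapK //; exact: chart_at_dom].
Qed.

Lemma dfunD U phi psi p u : U p -> smooth_on U phi -> smooth_on U psi ->
  dfun (fun q => phi q + psi q) p u = dfun phi p u + dfun psi p u.
Proof.
move=> Up hp hq; have dp := chart_at_dom p; rewrite /dfun -deriveD //.
- exact/diff_derivable/(smooth_on_differentiable dp Up hp).
- exact/diff_derivable/(smooth_on_differentiable dp Up hq).
Qed.

Lemma dfunM U phi psi p u : U p -> smooth_on U phi -> smooth_on U psi ->
  dfun (fun q => phi q * psi q) p u = phi p * dfun psi p u + psi p * dfun phi p u.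
Proof.
move=> Up hp hq; have dp := chart_at_dom p; rewrite /dfun.
have := smooth_on_differentiable dp Up hp.
have := smooth_on_differentiable dp Up hq.
set f := fun x => psi _; set g := fun x => phi _ => df dg.
have -> : phi p = g (cmap (chart_at p) p) by rewrite /g cmapK.
have -> : psi p = f (cmap (chart_at p) p) by rewrite /f cmapK.
by rewrite -deriveM //; exact: diff_derivable.
Qed.

(** Tangent vectors at [p] are written in the chart at [p], so that chart's coordinates read off
    their components. *)
Lemma dfun_coord_self p j u : dfun (Defs.coord p j) p u = u 0 j.
Proof.
rewrite /dfun (_ : 'D_u _ _ = 'D_u (fun x : 'rV[R]_m => x 0 j) (cmap (chart_at p) p)).
  have /matrixP/(_ 0 j) := derive_mx (@derivable_id _ _ (cmap (chart_at p) p) u).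
  by rewrite derive_id mxE.
apply: near_eq_derive.
apply: (open_near_eq (@open_ccod _ _ _ (chart_at p))) => [x cx|].
  by rewrite /Defs.coord cinvK.
exact/cmapP/chart_at_dom.
Qed.

(** A bump on the chart's codomain is transported to [M] and extended by zero. The Hausdorff
    property makes the image of its compact set closed, hence the extension is smooth across the
    edge of the chart domain. *)
Lemma smooth_bump p : exists (chi : M -> R) (K : set M),
  [/\ smooth chi, chi p = 1, closed K, K `<=` cdom (chart_at p) &
      forall q, ~ K q -> chi q = 0].
Proof.
have dp := chart_at_dom p.
have [b [K [bs b1 cK KO bK]]] := bump_row (@open_ccod _ _ _ (chart_at p)) (cmapP dp).
pose c := chart_at p.
pose chi q := if `[< cdom c q >] then b (cmap c q) else 0.
have KE : closed (cinv c @` K).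
  apply: compact_closed; first exact: manifold_hausdorff.
  apply: continuous_compact => //; apply: continuous_in_subspaceT => x.
  by rewrite inE => /KO cx; exact: cinv_continuous.
have chi0 q : ~ (cinv c @` K) q -> chi q = 0.
  move=> nK; rewrite /chi; case: asboolP => // dq; apply: bK => Kq.
  by apply: nK; exists (cmap c q) => //; rewrite cmapK.
have KD : cinv c @` K `<=` cdom c by move=> _ [x /KO cx <-]; exact: cinvP.
exists chi, (cinv c @` K); split => //; last first.
  by rewrite /chi asboolT.
apply: (@smooth_on_bigcup bool
  (fun i => if i then cdom c else ~` (cinv c @` K))).
  move=> q _; have [dq|nq] := pselect (cdom c q); first by exists true.
  by exists false => /KD.
case.
  apply: (@smooth_on_eq _ (fun q => b (cmap c q))); first exact: open_cdom.
    by move=> q dq; rewrite /chi asboolT.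
  apply: smooth_on_sub (smooth_on_comp_chart p openT bs) => q dq; by split.
apply: (@smooth_on_eq _ (fun=> 0)); first exact: closed_openC.
  by move=> q /chi0.
exact: smooth_on_cst.
Qed.

(** [U] is covered by its intersections with [V] and with the complement of [K], and on the latter
    the product is zero. The values of [psi] outside [V] are thus harmless. *)
Lemma smooth_on_cutoff U V (K : set M) chi psi : open U -> open V -> closed K ->
  K `<=` V -> (forall q, ~ K q -> chi q = 0) -> smooth chi ->
  smooth_on (U `&` V) psi -> smooth_on U (fun q => chi q * psi q).
Proof.
move=> oU oV cK KV chi0 sc sp.
apply: (@smooth_on_bigcup bool (fun i => U `&` if i then V else ~` K)).
  move=> q Uq; have [Vq|nq] := pselect (V q); first by exists true.
  by exists false; split => // /KV.
case.
  by apply: smooth_onM => //; [exact: openI|exact: smooth_on_sub sc].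
apply: (@smooth_on_eq _ (fun=> 0)).
- by apply: openI => //; exact: closed_openC.
- by move=> q [_ /chi0 ->]; rewrite mul0r.
- exact: smooth_on_cst.
Qed.

End SmoothFunctions.

(** * Smooth maps and vector fields along them *)

(** Ordinary vector fields are fields along the identity, so results along a map apply to them
    through this. *)
Lemma smooth_map_id (R : realType) m (M : manifold R m) : @smooth_map R m m M M (fun p => p).
Proof. by split=> [p|c j]; [exact: cvg_id|exact (@smooth_coord _ _ M c j)]. Qed.

Section SmoothMaps.
Context {R : realType} {m k : nat} {M : manifold R m} {N : manifold R k}.
Variables (F : M -> N) (sF : smooth_map F).
Implicit Types (U : set N) (p q : M) (V W : M -> 'rV[R]_k).

Let cF : continuous F := sF.1.

Lemma open_preimage U : open U -> open [set q | U (F q)].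
Proof. by move=> oU; apply: open_comp oU => q _; exact: cF. Qed.

Lemma smooth_on_comp U (Phi : N -> R) : open U -> smooth_on U Phi ->
  smooth_on [set q | U (F q)] (fun q => Phi (F q)).
Proof.
move=> oU hP.
have oc (c : N) := open_cdom (chart_at c).
have dc (c : N) := open_preimage (oc c).
apply: (@smooth_on_bigcup _ _ _ N (fun c => [set q | cdom (chart_at c) (F q) /\ U (F q)])).
  by move=> q Uq; exists (F q); split => //; exact: chart_at_dom.
(* On this piece the composite factors through the chart at [c], and [Cn_comp] applies to the
   coordinate expressions. *)
move=> c; apply: (@smooth_on_eq _ _ _ _
    (fun q => Phi (cinv (chart_at c) (cmap (chart_at c) (F q))))).
- exact: (openI (dc c) (open_preimage oU)).
- by move=> q [dq _]; rewrite cmapK.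
move=> p n.
apply: (@Cn_comp _ _ _ _ _ [set x | ccod (chart_at c) x /\ U (cinv (chart_at c) x)]
  (fun x => cmap (chart_at c) (F (cinv (chart_at p) x)))
  (fun x => Phi (cinv (chart_at c) x))).
- exact/open_in_chart/(openI (dc c) (open_preimage oU)).
- by move=> x [cx [dx Ux]]; split; [exact: cmapP|rewrite cmapK].
- move=> j; apply: Cn_sub (sF.2 c j p n).
  by move=> x [cx [dx _]].
- exact: hP.
Qed.

(* Contains both the chain rule (c = F p) and the change of charts (F = id). *)
Lemma dfun_comp_chart (c : N) U (Phi : N -> R) p u : open U -> U (F p) ->
  smooth_on U Phi -> cdom (chart_at c) (F p) ->
  dfun (fun q => Phi (F q)) p u =
  \sum_j dfun (fun q => Defs.coord c j (F q)) p u
         * 'D_(delta_mx 0 j) (fun x => Phi (cinv (chart_at c) x))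
                             (cmap (chart_at c) (F p)).
Proof.
move=> oU Up hP dp; have pp := chart_at_dom p.
have oc := open_preimage (open_cdom (chart_at c)).
rewrite (@dfun_eq _ _ _ _ _
  (fun q => Phi (cinv (chart_at c) (cmap (chart_at c) (F q)))) p u oc dp); last first.
  by move=> q dq; rewrite cmapK.
rewrite /dfun.
rewrite (@derive_comp_row _ _ _ (fun x => cmap (chart_at c) (F (cinv (chart_at p) x)))
  (fun x => Phi (cinv (chart_at c) x))).
- by apply: eq_bigr => j _; rewrite cmapK.
- move=> j; exact: (smooth_on_differentiable pp dp (sF.2 c j)).
- rewrite cmapK //; exact: (smooth_on_differentiable dp Up hP).
Qed.

Lemma dfun_comp U (Phi : N -> R) p u : open U -> U (F p) -> smooth_on U Phi ->
  dfun (fun q => Phi (F q)) p u = dfun Phi (F p) (tmap F p u).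
Proof.
move=> oU Up hP; rewrite (dfun_comp_chart _ oU Up hP (chart_at_dom _)).
rewrite (dfun_sum_delta _ Up hP); apply: eq_bigr => j _.
by rewrite mxE.
Qed.

Lemma tmap_linear p a u v : tmap F p (a *: u + v) = a *: tmap F p u + tmap F p v.
Proof.
apply/rowP => j; rewrite !mxE.
have dp : [set q | cdom (chart_at (F p)) (F q)] p by exact: chart_at_dom.
by rewrite (dfunDr _ _ dp (sF.2 (F p) j)) (dfunZr _ _ dp (sF.2 (F p) j)).
Qed.

End SmoothMaps.

Lemma dfun_chart (R : realType) k (N : manifold R k) (c : N) (U : set N)
    (Phi : N -> R) q u : open U -> U q -> smooth_on U Phi -> cdom (chart_at c) q ->
  dfun Phi q u = \sum_j dfun (Defs.coord c j) q u
         * 'D_(delta_mx 0 j) (fun x => Phi (cinv (chart_at c) x))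
                             (cmap (chart_at c) q).
Proof. exact: (dfun_comp_chart (smooth_map_id N)). Qed.

(* The coordinate frame of the chart at c; its values are expressed in the chart
   at the running point q, as all tangent vectors are. *)
Definition frame (R : realType) k (N : manifold R k) (c : N) (a : 'I_k) (q : N) : 'rV[R]_k :=
  \row_j 'D_(delta_mx 0 a) (fun x => Defs.coord q j (cinv (chart_at c) x))
                           (cmap (chart_at c) q).

Section Frame.
Context {R : realType} {k : nat} {N : manifold R k}.
Variable c : N.

Lemma frame_expansion q u : cdom (chart_at c) q ->
  u = \sum_a dfun (Defs.coord c a) q u *: frame c a q.
Proof.
move=> dq; apply/rowP => j; rewrite summxE -[LHS](dfun_coord_self q j u).
rewrite (dfun_chart _ (open_cdom _) (chart_at_dom q) (smooth_coord q j) dq).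
by apply: eq_bigr => a _; rewrite !mxE.
Qed.

(** The entries of [frame c a q] form a column of partial derivatives of the transition map from the
    chart at [c] to the chart at [q]; the chain rule does the rest. *)
Lemma dfun_frame U (Phi : N -> R) a q : open U -> U q -> smooth_on U Phi ->
  cdom (chart_at c) q ->
  dfun Phi q (frame c a q)
  = 'D_(delta_mx 0 a) (fun x => Phi (cinv (chart_at c) x)) (cmap (chart_at c) q).
Proof.
move=> oU Uq hP dq; have qq := chart_at_dom q.
have oO := open_in_chart (p := c) (open_cdom (chart_at q)).
have xO : [set x | ccod (chart_at c) x /\ cdom (chart_at q) (cinv (chart_at c) x)]
   (cmap (chart_at c) q).
  by split; [exact: cmapP|rewrite cmapK].
rewrite [RHS](@near_eq_derive _ _ _ _ (fun x => Phi (cinv (chart_at q)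
   (cmap (chart_at q) (cinv (chart_at c) x))))); last first.
  by apply: (open_near_eq oO) => // x [_ dx]; rewrite cmapK.
rewrite (@derive_comp_row _ _ _ (fun x => cmap (chart_at q) (cinv (chart_at c) x))
  (fun x => Phi (cinv (chart_at q) x))).
- rewrite (dfun_sum_delta _ Uq hP); apply: eq_bigr => j _.
  by rewrite mxE cmapK.
- move=> j; exact: (smooth_on_differentiable dq qq (smooth_coord q j)).
- rewrite cmapK //; exact: (smooth_on_differentiable qq Uq hP).
Qed.

(** The frame is written in a chart that varies with [q]. [dfun_frame] removes this dependence,
    leaving a single partial derivative read in the chart at [c]. *)
Lemma smooth_dfun_frame U (Phi : N -> R) a : open U -> smooth_on U Phi ->
  smooth_on (cdom (chart_at c) `&` U) (fun q => dfun Phi q (frame c a q)).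
Proof.
move=> oU hP; have oc := open_cdom (chart_at c).
pose f := 'D_(delta_mx 0 a) (fun x => Phi (cinv (chart_at c) x)).
apply: (@smooth_on_eq _ _ _ _ (fun q => f (cmap (chart_at c) q))).
- exact: openI.
- by move=> q [dq Uq]; rewrite (dfun_frame _ oU Uq hP dq).
have h := @smooth_on_comp_chart _ _ _ c _ f (open_in_chart (p := c) oU)
  (fun n => (hP c n.+1).2 _).
apply: smooth_on_sub h => q [dq Uq]; split => //=.
by rewrite cmapK //; split => //; exact: cmapP.
Qed.

Lemma frame_self a : frame c a c = delta_mx 0 a.
Proof.
by apply/rowP => j; rewrite mxE [LHS]dfun_coord_self.
Qed.

End Frame.

(** * Smooth vector fields along a map *)

Section FieldsAlong.
Context {R : realType} {m k : nat} {M : manifold R m} {N : manifold R k}.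
Variables (F : M -> N) (sF : smooth_map F).
Implicit Types (U : set N) (p q : M) (V W : M -> 'rV[R]_k).

Let odom (c : N) : open [set q | cdom (chart_at c) (F q)] :=
  open_preimage sF (open_cdom (chart_at c)).

(** Over each chart domain [V] is expanded in the coordinate frame; its coefficients are smooth by
    the definition of [vfield_along]. *)
Lemma smooth_dfun_along U (Phi : N -> R) V : open U -> smooth_on U Phi ->
  vfield_along F V -> smooth_on [set q | U (F q)] (fun q => dfun Phi (F q) (V q)).
Proof.
move=> oU hP hV.
apply: (@smooth_on_bigcup _ _ _ N (fun c => [set q | (cdom (chart_at c) `&` U) (F q)])).
  by move=> q Uq; exists (F q); split => //; exact: chart_at_dom.
move=> c; have oV := open_preimage sF (openI (open_cdom (chart_at c)) oU).
apply: (@smooth_on_eq _ _ _ _ (fun q => \sum_a dfun (Defs.coord c a) (F q) (V q)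
   * dfun Phi (F q) (frame c a (F q)))) => //.
  move=> q [dq Uq]; rewrite (dfun_chart (V q) oU Uq hP dq); apply: eq_bigr => a _.
  by rewrite (dfun_frame _ oU Uq hP dq).
apply: smooth_on_sum => // a; apply: smooth_onM => //.
  by apply: smooth_on_sub (hV c a) => q [].
exact (smooth_on_comp sF (openI (open_cdom (chart_at c)) oU)
  (smooth_dfun_frame c a oU hP)).
Qed.

Lemma vfield_alongD V W : vfield_along F V -> vfield_along F W ->
  vfield_along F (fun q => V q + W q).
Proof.
move=> hV hW c j.
apply: (@smooth_on_eq _ _ _ _ (fun q => dfun (Defs.coord c j) (F q) (V q)
   + dfun (Defs.coord c j) (F q) (W q))) => //.
  by move=> q dq; rewrite (@dfunDr _ _ _ (cdom (chart_at c)) _ _ _ _ dq (smooth_coord c j)).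
exact (smooth_onD (odom c) (hV c j) (hW c j)).
Qed.

Lemma vfield_alongZ phi V : smooth phi -> vfield_along F V ->
  vfield_along F (fun q => phi q *: V q).
Proof.
move=> hp hV c j.
apply: (@smooth_on_eq _ _ _ _ (fun q => phi q * dfun (Defs.coord c j) (F q) (V q))) => //.
  by move=> q dq; rewrite (@dfunZr _ _ _ (cdom (chart_at c)) _ _ _ _ dq (smooth_coord c j)).
by apply: smooth_onM => //; exact: smooth_on_sub hp.
Qed.

Lemma vfield_along_cst0 : vfield_along F (fun=> 0).
Proof.
move=> c j; apply: (@smooth_on_eq _ _ _ _ (fun=> 0)) => //; last exact: smooth_on_cst.
move=> q dq; rewrite -[X in dfun _ _ X](scale0r (0 : 'rV[R]_k)).
by rewrite (@dfunZr _ _ _ (cdom (chart_at c)) _ _ _ _ dq (smooth_coord c j)) mul0r.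
Qed.

Lemma vfield_along_sum I (r : seq I) (V : I -> M -> 'rV[R]_k) :
  (forall i, vfield_along F (V i)) -> vfield_along F (fun q => \sum_(i <- r) V i q).
Proof.
move=> h; elim: r => [|i r IH].
  by under eq_fun do rewrite big_nil; exact: vfield_along_cst0.
by under eq_fun do rewrite big_cons; exact (vfield_alongD (h i) IH).
Qed.

Lemma vfield_along_comp (Z : N -> 'rV[R]_k) : vfield Z -> vfield_along F (fun q => Z (F q)).
Proof. by move=> hZ c j; exact (smooth_on_comp sF (open_cdom (chart_at c)) (hZ c j)). Qed.

Lemma vfield_along_local V :
  (forall p, exists phi, [/\ smooth phi, phi p != 0 &
                             vfield_along F (fun q => phi q *: V q)]) ->
  vfield_along F V.
Proof.
move=> /choice[phi h] c j.
apply: (@smooth_on_bigcup _ _ _ M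
  (fun p => [set q | cdom (chart_at c) (F q) /\ phi p q != 0])).
  by move=> q dq; exists q; split => //; case: (h q).
move=> p; have [sp _ spV] := h p.
have oU : open [set q | phi p q != 0].
  apply: (@open_comp _ _ (phi p) [set x | x != 0]); last exact: open_neq.
  by move=> q _; apply: smooth_on_continuous sp => //; exact: openT.
have oc := openI (odom c) oU.
apply: (@smooth_on_eq _ _ _ _ (fun q => (phi p q)^-1 *
   dfun (Defs.coord c j) (F q) (phi p q *: V q))) => //.
  move=> q [dq /= q0]; rewrite (@dfunZr _ _ _ (cdom (chart_at c)) _ _ _ _ dq (smooth_coord c j)).
  by rewrite mulrA mulVf ?mul1r.
apply: smooth_onM => //; last by apply: smooth_on_sub (spV c j) => q [].
by apply: smooth_onV => // [q []//|]; exact: smooth_on_sub sp.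
Qed.

End FieldsAlong.

Lemma vfield_tmap (R : realType) m k (M : manifold R m) (N : manifold R k)
    (F : M -> N) (X : M -> 'rV[R]_m) : smooth_map F -> vfield X ->
  vfield_along F (fun q => tmap F q (X q)).
Proof.
move=> sF hX c j; have oc := open_preimage sF (open_cdom (chart_at c)).
apply: (@smooth_on_eq _ _ _ _ (fun q => dfun (fun q => Defs.coord c j (F q)) q (X q))) => //.
  by move=> q dq; rewrite (dfun_comp sF _ (open_cdom _) dq (smooth_coord c j)).
exact: (smooth_dfun_along (smooth_map_id M) oc (sF.2 c j) hX).
Qed.

(** One factor of the bump [chi] makes the frame fields global and another makes the coefficients
    global; this is why [phi] is the square of [chi] along [F]. *)
Lemma frame_decomposition (R : realType) m k (M : manifold R m) (N : manifold R k)
    (F : M -> N) (c : N) : smooth_map F ->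
  exists (phi : M -> R) (Z : 'I_k -> N -> 'rV[R]_k),
    [/\ smooth phi, forall p, F p = c -> phi p = 1, forall a, vfield (Z a),
        forall a, Z a c = delta_mx 0 a &
        forall V, vfield_along F V -> exists f : 'I_k -> M -> R,
          (forall a, smooth (f a)) /\
          forall q, phi q *: V q = \sum_a f a q *: Z a (F q)].
Proof.
move=> sF; have [chi [K [sc c1 cK KD K0]]] := smooth_bump c.
have odc := open_cdom (chart_at c).
have scF : smooth (fun q => chi (F q)) := smooth_on_comp sF openT sc.
exists (fun q => chi (F q) * chi (F q)), (fun a q => chi q *: frame c a q); split.
- by apply: smooth_onM => //; exact: openT.
- by move=> p ->; rewrite c1 mulr1.
- move=> a c' j; have oc' := open_cdom (chart_at c').
  apply: (@smooth_on_eq _ _ _ _ (fun q => chi q * dfun (Defs.coord c' j) q (frame c a q))) => //.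
    by move=> q dq; rewrite (@dfunZr _ _ _ (cdom (chart_at c')) _ _ _ _ dq (smooth_coord c' j)).
  apply: (smooth_on_cutoff oc' odc cK KD K0 sc).
  by rewrite setIC; exact: (smooth_dfun_frame c a oc' (smooth_coord c' j)).
- by move=> a; rewrite c1 scale1r frame_self.
move=> V hV; exists (fun a q => chi (F q) * dfun (Defs.coord c a) (F q) (V q)); split.
  move=> a; apply: (@smooth_on_cutoff _ _ _ setT [set q | cdom (chart_at c) (F q)]
    [set q | K (F q)]).
  - exact: openT.
  - exact: open_preimage.
  - by apply: closed_comp cK => q _; exact: sF.1.
  - by move=> q /KD.
  - by move=> q /K0.
  - exact: scF.
  - by rewrite setTI; exact: hV.
(* Outside the chart domain the frame and the coefficients have arbitrary values, but [chi] vanishes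
   there. *)
move=> q; have [dq|ndq] := pselect (cdom (chart_at c) (F q)); last first.
  have -> : chi (F q) = 0 by apply: K0 => /KD.
  by rewrite mul0r scale0r big1 // => a _; rewrite mul0r scale0r.
rewrite {1}(frame_expansion (V q) dq) scaler_sumr; apply: eq_bigr => a _.
by rewrite !scalerA mulrAC.
Qed.

(* Extends tangent vectors at F p to global fields, in such a way that every
   tensorial operation on fields along F can be computed at p on these. *)
Lemma tensorial_extension (R : realType) m k (M : manifold R m) (N : manifold R k)
    (F : M -> N) (p : M) : smooth_map F ->
  exists ext : 'rV[R]_k -> N -> 'rV[R]_k,
    [/\ forall v, vfield (ext v), forall v, ext v (F p) = v &
        forall (L : lmodType R) (T : (M -> 'rV[R]_k) -> L),
          (forall V W, vfield_along F V -> vfield_along F W ->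
             T (fun q => V q + W q) = T V + T W) ->
          (forall phi V, smooth phi -> vfield_along F V ->
             T (fun q => phi q *: V q) = phi p *: T V) ->
          forall V, vfield_along F V -> T V = T (fun q => ext (V p) (F q))].
Proof.
move=> sF; have [phi [Z [sphi phi1 hZ Zc hV]]] := frame_decomposition (F p) sF.
(* Constant coefficients suffice, since the [Z a] form the standard basis at [F p]. *)
exists (fun v q => \sum_a v 0 a *: Z a q); split.
- move=> v; apply: (vfield_along_sum (smooth_map_id N)) => a.
  exact (vfield_alongZ (smooth_map_id N) (smooth_on_cst setT (v 0 a)) (hZ a)).
- by move=> v; rewrite [RHS]row_sum_delta; apply: eq_bigr => a _; rewrite Zc.
move=> L T TD TZ V sV; have [f [sf fE]] := hV V sV.
have ZF a : vfield_along F (fun q => Z a (F q)) by exact: vfield_along_comp.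
have Tsum (g : 'I_k -> M -> R) (r : seq 'I_k) : (forall a, smooth (g a)) ->
    T (fun q => \sum_(a <- r) g a q *: Z a (F q))
    = \sum_(a <- r) g a p *: T (fun q => Z a (F q)).
  move=> sg; elim: r => [|a r IH].
    under eq_fun do rewrite big_nil.
    (* [T] sends the zero field to zero by homogeneity under the zero function. *)
    rewrite big_nil -(scale0r (T (fun=> 0))) -(TZ (fun=> 0) (fun=> 0)).
    - by under [in RHS]eq_fun do rewrite scale0r.
    - exact: smooth_on_cst.
    - exact: vfield_along_cst0.
  under eq_fun do rewrite big_cons.
  rewrite TD; [|exact: vfield_alongZ|]; last first.
    by apply: vfield_along_sum => // b; exact: vfield_alongZ.
  by rewrite big_cons IH TZ.
have fp a : f a p = V p 0 a.
  have := fE p; rewrite phi1 // scale1r => ->; rewrite summxE (bigD1 a) //= big1.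
    by rewrite Zc !mxE !eqxx mulr1 addr0.
  by move=> b ba; rewrite Zc !mxE eq_sym (negbTE ba) mulr0.
(* As [phi p = 1], the field [V] may be replaced by [phi] times [V], which is a combination of the
   [Z a]. *)
rewrite -[LHS]scale1r -(phi1 p) // -TZ //.
rewrite (_ : (fun q => phi q *: V q) = (fun q => \sum_a f a q *: Z a (F q))).
  rewrite Tsum // (Tsum (fun a _ => V p 0 a)); last by move=> a; exact: smooth_on_cst.
  by apply: eq_bigr => a _; rewrite fp.
by apply/funext => q; rewrite fE.
Qed.

(** * The pulled-back connection *)

(* Unification would otherwise unfold these down to limits. *)
#[local] Opaque dfun.

(** * Bilinearity and symmetry of the inner product *)

Section Inner.
Context {R : realType} {k : nat}.
Implicit Types (g : 'M[R]_k) (u v w : 'rV[R]_k).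

Lemma innerDl g u v w : inner g (u + v) w = inner g u w + inner g v w.
Proof. by rewrite /inner !mulmxDl mxE. Qed.

Lemma innerDr g u v w : inner g u (v + w) = inner g u v + inner g u w.
Proof. by rewrite /inner raddfD /= mulmxDr mxE. Qed.

Lemma innerZl g a u v : inner g (a *: u) v = a * inner g u v.
Proof. by rewrite /inner -!scalemxAl mxE. Qed.

Lemma innerZr g a u v : inner g u (a *: v) = a * inner g u v.
Proof. by rewrite /inner linearZ /= -scalemxAr mxE. Qed.

Lemma inner0l g v : inner g 0 v = 0.
Proof. by rewrite -(scale0r 0) innerZl mul0r. Qed.

Lemma innerNl g u v : inner g (- u) v = - inner g u v.
Proof. by rewrite -scaleN1r innerZl mulN1r. Qed.

Lemma innerNr g u v : inner g u (- v) = - inner g u v.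
Proof. by rewrite -scaleN1r innerZr mulN1r. Qed.

Lemma innerBl g u v w : inner g (u - v) w = inner g u w - inner g v w.
Proof. by rewrite innerDl innerNl. Qed.

Lemma innerBr g u v w : inner g u (v - w) = inner g u v - inner g u w.
Proof. by rewrite innerDr innerNr. Qed.

Lemma inner_suml g I (r : seq I) (u : I -> 'rV[R]_k) v :
  inner g (\sum_(i <- r) u i) v = \sum_(i <- r) inner g (u i) v.
Proof.
elim/big_rec2: _ => [|i x y _ <-]; last exact: innerDl.
exact: inner0l.
Qed.

Lemma inner_sumr g I (r : seq I) u (v : I -> 'rV[R]_k) :
  inner g u (\sum_(i <- r) v i) = \sum_(i <- r) inner g u (v i).
Proof.
elim/big_rec2: _ => [|i x y _ <-]; last exact: innerDr.
by rewrite -(scale0r 0) innerZr mul0r.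
Qed.

Lemma innerC g u v : g^T = g -> inner g u v = inner g v u.
Proof.
move=> gT; rewrite /inner -[in RHS](trmxK (v *m g *m u^T)) [RHS]mxE.
by rewrite !trmx_mul trmxK gT mulmxA.
Qed.

End Inner.

(** The term [c * e], carrying the derivative of the coefficient, cancels: this is what makes the
    Hessian along a map tensorial. *)
Lemma leibniz_defect (R : comNzRingType) (a b c e f : R) :
  a * b + c * e - (e * c + a * f) = a * (b - f).
Proof. ring. Qed.

Lemma sub_swap (V : zmodType) (a b x y : V) : a - x = b - y -> x - y = a - b.
Proof.
move=> /eqP; rewrite subr_eq => /eqP ->.
by rewrite -[b - y + x]addrA [b + _]addrC addrK addrC.
Qed.

(** * Metric, torsion and nearly Kähler identities along a map *)

Section Pullback.
Context {R : realType} {m k : nat} {M : manifold R m} {N : manifold R k}.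
Variables (F : M -> N) (sF : smooth_map F).
Implicit Types (V W : M -> 'rV[R]_k) (X Y : M -> 'rV[R]_m) (p : M).

(** [smooth_tensor11] speaks of global fields only. After multiplication by a bump, [V] is a
    combination of restrictions of global fields. *)
Lemma vfield_along_tensor11 (f : N -> 'M[R]_k) V : smooth_tensor11 f ->
  vfield_along F V -> vfield_along F (fun q => V q *m f (F q)).
Proof.
move=> sf hV; apply: (vfield_along_local sF) => p.
have [phi [Z [sphi phi1 hZ _ hd]]] := frame_decomposition (F p) sF.
exists phi; split; [exact: sphi|by rewrite phi1 // oner_eq0|].
have [c [sc cE]] := hd V hV.
rewrite (_ : (fun q => _) = (fun q => \sum_a c a q *: (Z a (F q) *m f (F q)))).
  apply: (vfield_along_sum sF) => a.
  exact: (vfield_alongZ sF (sc a) (vfield_along_comp sF (sf _ (hZ a)))).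
apply/funext => q; rewrite scalemxAl cE mulmx_suml.
by apply: eq_bigr => a _; rewrite scalemxAl.
Qed.

Lemma smooth_inner_along (g : N -> 'M[R]_k) V W : riemannian_metric g ->
  vfield_along F V -> vfield_along F W ->
  smooth (fun q => inner (g (F q)) (V q) (W q)).
Proof.
move=> [_ _ sg] hV hW; apply: smooth_local => p.
have [phi [Z [sphi phi1 hZ _ hd]]] := frame_decomposition (F p) sF.
exists (fun q => phi q * phi q); split.
- by apply: smooth_onM => //; exact: openT.
- by rewrite phi1 // mulr1 oner_eq0.
have [c [sc cE]] := hd V hV; have [d [sd dE]] := hd W hW.
rewrite (_ : (fun q => _) = (fun q => \sum_a \sum_b (c a q * d b q)
    * inner (g (F q)) (Z a (F q)) (Z b (F q)))).
  refine (smooth_on_sum _ openT _) => a; refine (smooth_on_sum _ openT _) => b.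
  exact: (smooth_onM openT (smooth_onM openT (sc a) (sd b))
    (smooth_on_comp sF openT (sg _ _ (hZ a) (hZ b)))).
apply/funext => q; rewrite -mulrA -innerZr -innerZl cE dE inner_suml.
apply: eq_bigr => a _; rewrite inner_sumr; apply: eq_bigr => b _.
by rewrite innerZl innerZr mulrA.
Qed.

Variables (nablaN : (N -> 'rV[R]_k) -> (N -> 'rV[R]_k) -> N -> 'rV[R]_k).
Variables (D : (M -> 'rV[R]_m) -> (M -> 'rV[R]_k) -> M -> 'rV[R]_k).
Hypothesis (DN : induced_connection F nablaN D).

Lemma pullback_metric (g : N -> 'M[R]_k) X V W p :
  riemannian_metric g -> levi_civita g nablaN ->
  vfield X -> vfield_along F V -> vfield_along F W ->
  dfun (fun q => inner (g (F q)) (V q) (W q)) p (X p)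
  = inner (g (F p)) (D X V p) (W p) + inner (g (F p)) (V p) (D X W p).
Proof.
move=> hg [_ _ hm] hX hV hW; have [sym _ _] := hg.
have [[_ _ _ DD DZ] Dc] := DN.
(* The failure of [D] to be metric. The type [R^o] views the scalars as a module, as
   [tensorial_extension] requires. *)
pose T W V : R^o := dfun (fun q => inner (g (F q)) (V q) (W q)) p (X p)
  - (inner (g (F p)) (D X V p) (W p) + inner (g (F p)) (V p) (D X W p)).
have [ext [hext extp tens]] := tensorial_extension p sF.
have TE V' W' : vfield_along F V' -> vfield_along F W' ->
    T W' V' = T W' (fun q => ext (V' p) (F q)).
  move=> hV' hW'; apply: tens => // [V1 V2 h1 h2|phi V1 sphi h1]; rewrite /T.
    under eq_fun do rewrite innerDl.
    rewrite (@dfunD _ _ _ setT) //; [|exact: smooth_inner_along..].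
    by rewrite DD // !innerDl; ring.
  under eq_fun do rewrite innerZl.
  rewrite (@dfunM _ _ _ setT) //; last exact: smooth_inner_along.
  rewrite DZ // innerDl !innerZl /GRing.scale /=; ring.
(* By symmetry, tensoriality in one field gives it in the other, so both can be replaced by
   extensions. *)
have TC V' W' : T W' V' = T V' W'.
  rewrite /T (_ : (fun q => inner _ (V' q) (W' q)) = (fun q => inner (g (F q)) (W' q) (V' q))).
    by rewrite (innerC (D X V' p)) // (innerC (V' p)) // [X in _ - X]addrC.
  by apply/funext => q; rewrite innerC.
apply/eqP; rewrite -subr_eq0; apply/eqP; rewrite -[LHS]/(T W V).
rewrite TE // TC TE //; last exact: vfield_along_comp.
set w := ext (W p); set v := ext (V p).
rewrite /T (@dfun_comp _ _ _ _ _ _ sF setT (fun q => inner (g q) (w q) (v q))) //;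
  [|exact: openT|by case: hg => _ _; apply; exact: hext].
(* The pushed-forward direction becomes the value of a global field on [N], so that metricity of
   [nablaN] applies. *)
rewrite -(extp (tmap F p (X p))) hm //; [|exact: hext..].
rewrite (Dc X (ext (tmap F p (X p))) w) // ?(Dc X (ext (tmap F p (X p))) v) ?subrr //;
  exact: hext.
Qed.

(** A coordinate times a bump is a global test function; in the product rule the derivatives of the
    bump agree on both sides and cancel. *)
Lemma eq_dfun (c : N) u v : (forall Phi : N -> R, smooth Phi -> dfun Phi c u = dfun Phi c v) ->
  u = v.
Proof.
move=> h; apply/rowP => j; have [chi [K [sc c1 cK KD K0]]] := smooth_bump c.
have cc := chart_at_dom c.
have sp : smooth (fun q => chi q * Defs.coord c j q).
  apply: (smooth_on_cutoff openT (open_cdom (chart_at c)) cK KD K0 sc).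
  by rewrite setTI; exact: smooth_coord.
have := h _ sp.
have sc' : smooth_on (cdom (chart_at c)) chi by exact: smooth_on_sub sc.
rewrite !(dfunM _ cc sc' (@smooth_coord _ _ _ c j)) (h chi sc) => /addIr.
by rewrite c1 !mul1r !dfun_coord_self.
Qed.

(** Both sides are tested on functions [Phi]. Torsion-freeness of [nablaN] is the symmetry of the
    Hessian of [Phi], and that of [nabla] gives the bracket acting on the composite of [Phi] with
    [F]. *)
Lemma pullback_torsion (g : N -> 'M[R]_k) (gM : M -> 'M[R]_m)
    (nabla : (M -> 'rV[R]_m) -> (M -> 'rV[R]_m) -> M -> 'rV[R]_m) X Y p :
  levi_civita g nablaN -> levi_civita gM nabla -> vfield X -> vfield Y ->
  D X (fun q => tmap F q (Y q)) p - D Y (fun q => tmap F q (X q)) p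
  = tmap F p (nabla X Y p - nabla Y X p).
Proof.
move=> [_ tN _] [_ tM _] hX hY; have [[_ _ _ DD DZ] Dc] := DN.
apply: (@eq_dfun (F p)) => Phi sPhi.
have [ext [hext extp tens]] := tensorial_extension p sF.
have sF1 := smooth_on_comp sF openT sPhi.
have dPhi V : vfield_along F V -> smooth (fun q => dfun Phi (F q) (V q)).
  by move=> hV; exact: (smooth_dfun_along sF openT sPhi hV).
have PhiD c u v : dfun Phi c (u + v) = dfun Phi c u + dfun Phi c v := dfunDr u v I sPhi.
have PhiZ c a u : dfun Phi c (a *: u) = a * dfun Phi c u := dfunZr a u I sPhi.
have PhiB c u v : dfun Phi c (u - v) = dfun Phi c u - dfun Phi c v.
  by rewrite -scaleN1r PhiD PhiZ mulN1r.
(* The Hessian of Phi. *)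
pose H A B : R := dfun (fun q => dfun Phi q (B q)) (F p) (A (F p))
                  - dfun Phi (F p) (nablaN A B (F p)).
have HC A B : vfield A -> vfield B -> H A B = H B A.
  move=> hA hB; have := tN A B Phi hA hB sPhi (F p).
  by rewrite PhiB => /esym/sub_swap/esym.
(* The Hessian formed with [D] is tensorial in [V], hence equals the Hessian on [N] of the extended
   vectors. *)
have BH A V : vfield A -> vfield_along F V ->
    dfun (fun q => dfun Phi (F q) (V q)) p (A p) - dfun Phi (F p) (D A V p)
    = H (ext (tmap F p (A p))) (ext (V p)).
  move=> hA hV.
  pose T V : R^o := dfun (fun q => dfun Phi (F q) (V q)) p (A p) - dfun Phi (F p) (D A V p).
  apply: etrans (tens _ T _ _ V hV) _ => [V1 V2 h1 h2|phi V1 sphi h1|]; rewrite /T.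
  - under eq_fun do rewrite PhiD.
    by rewrite (dfunD _ I (dPhi _ h1) (dPhi _ h2)) DD // PhiD opprD addrACA.
  - under eq_fun do rewrite PhiZ.
    rewrite (dfunM _ I sphi (dPhi _ h1)) DZ // PhiD !PhiZ.
    exact: leibniz_defect.
  - have sd : smooth (fun q => dfun Phi q (ext (V p) q)).
      exact: (smooth_dfun_along (smooth_map_id N) openT sPhi (hext _)).
    rewrite (dfun_comp sF (A p) openT I sd).
    by rewrite /H extp (Dc _ (ext (tmap F p (A p)))).
have hdX := vfield_tmap sF hX; have hdY := vfield_tmap sF hY.
have eX := BH X _ hX hdY; have eY := BH Y _ hY hdX.
have e := etrans eX (etrans (HC _ _ (hext _) (hext _)) (esym eY)).
apply: etrans (PhiB _ _ _) _.
apply: etrans _ (dfun_comp sF (nabla X Y p - nabla Y X p) openT I sPhi).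
apply: etrans _ (esym (tM X Y _ hX hY sF1 p)).
have ch Z : (fun q => dfun (fun q' => Phi (F q')) q (Z q))
    = (fun q => dfun Phi (F q) (tmap F q (Z q))).
  by apply/funext => q; exact: (dfun_comp sF (Z q) openT I sPhi).
rewrite (ch X) (ch Y); exact: sub_swap e.
Qed.

(** The commutator of [D] with [f] is tensorial. Both summands are computed on the same pair of
    extensions, in opposite order, so the ambient identity applies. *)
Lemma pullback_nearly_kahler (f g : N -> 'M[R]_k) X Y p :
  weak_nearly_kahler f g nablaN -> vfield X -> vfield Y ->
  let dX q := tmap F q (X q) in let dY q := tmap F q (Y q) in
  (D X (fun q => dY q *m f (F q)) p - D X dY p *m f (F p))
  + (D Y (fun q => dX q *m f (F q)) p - D Y dX p *m f (F p)) = 0.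
Proof.
move=> [[_ _ sf _ _] _ nk] hX hY dX dY; have [[_ _ _ DD DZ] Dc] := DN.
have [ext [hext extp tens]] := tensorial_extension p sF.
have TE A V : vfield A -> vfield_along F V ->
    D A (fun q => V q *m f (F q)) p - D A V p *m f (F p)
    = cov_tensor11 nablaN f (ext (tmap F p (A p))) (ext (V p)) (F p).
  move=> hA hV.
  pose T V := D A (fun q => V q *m f (F q)) p - D A V p *m f (F p).
  apply: etrans (tens _ T _ _ V hV) _ => [V1 V2 h1 h2|phi V1 sphi h1|]; rewrite /T.
  - under eq_fun do rewrite mulmxDl.
    rewrite !DD //; [|exact: vfield_along_tensor11..].
    by rewrite mulmxDl opprD addrACA.
  - under eq_fun do rewrite -scalemxAl.
    rewrite !DZ //; last exact: vfield_along_tensor11.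
    by rewrite mulmxDl -!scalemxAl opprD addrACA subrr add0r scalerBr.
  - rewrite (Dc A (ext (tmap F p (A p))) (fun q => ext (V p) q *m f q)) //.
    + by rewrite (Dc A (ext (tmap F p (A p)))).
    + exact/sf/hext.
by rewrite !TE ?nk //; exact: vfield_tmap.
Qed.

End Pullback.

(** * The second fundamental form *)

#[local] Opaque dfun vfield_along smooth_on inner tmap.

(** * Linear identities used for the second fundamental form *)

Section RealIdentities.
Context {R : realFieldType}.
Implicit Types a b c d e f : R.

Lemma sub_swapN a b c d e f : b + f = a + c -> c = d -> f = e -> a - b = - (d - e).
Proof. lra. Qed.

(** Six alternating transpositions, three of which change the sign, return to the start and give
    [a = - a]. *)
Lemma skew_sym_eq0 a b c d e f :
  a = - b -> b = c -> c = - d -> d = e -> e = - f -> f = a -> a = 0.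
Proof. lra. Qed.

Lemma sum_sym_cov a b c d e f : a + d = 0 -> f = c ->
  a - b + c + (d - e + f) = 2 * c - b - e.
Proof. lra. Qed.

Lemma subrBAC a b c e : a - b - (c - e) = a - c - b + e.
Proof. lra. Qed.

End RealIdentities.

(** * Symmetry and normality of [h], the Weingarten formula and the derivative of [f] *)

Section SecondFundamentalForm.
Context {R : realType} {m k s : nat} {M : manifold R m} {Mb : manifold R k}.
Variables (iota : M -> Mb) (fb gb : Mb -> 'M[R]_k).
Variables (nablab : (Mb -> 'rV[R]_k) -> (Mb -> 'rV[R]_k) -> Mb -> 'rV[R]_k).
Variables (N : 'I_s -> M -> 'rV[R]_k) (S : fstructure M s).
Variables (nabla : (M -> 'rV[R]_m) -> (M -> 'rV[R]_m) -> M -> 'rV[R]_m).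
Variables (D : (M -> 'rV[R]_m) -> (M -> 'rV[R]_k) -> M -> 'rV[R]_k).
Hypothesis (Mb_wnK : weak_nearly_kahler fb gb nablab).
Hypothesis (iota_sub : submanifold iota).
Hypothesis (N_normal : orthonormal_normals iota gb N).
Hypothesis (S_induced : induced_fstructure iota fb gb N S).
Hypothesis (nabla_LC : levi_civita (fs_g S) nabla).
Hypothesis (D_induced : induced_connection iota nablab D).

Let sF : smooth_map iota. Proof. by case: iota_sub. Qed.
Let hgb : riemannian_metric gb. Proof. by case: Mb_wnK => -[]. Qed.
Let LCb : levi_civita gb nablab. Proof. by case: Mb_wnK. Qed.
Local Notation d := (tmap iota).
Local Notation G p := (inner (gb (iota p))).
Local Notation h := (second_fundamental_form iota nabla D).

Let hE X Y p : h X Y p = D X (fun q => d q (Y q)) p - d p (nabla X Y p).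
Proof. by []. Qed.

Let dD p u v : d p (u + v) = d p u + d p v.
Proof. by rewrite -[u]scale1r [LHS](tmap_linear sF) !scale1r. Qed.

Let dZ p a u : d p (a *: u) = a *: d p u.
Proof.
have d0 : d p 0 = 0 by apply: (addrI (d p 0)); rewrite -dD !addr0.
by rewrite -[a *: u]addr0 [LHS](tmap_linear sF) d0 addr0.
Qed.

Let dB p u v : d p (u - v) = d p u - d p v.
Proof. by rewrite -scaleN1r dD dZ scaleN1r. Qed.

Let GC p u v : G p u v = G p v u.
Proof. by case: hgb => sym _ _; exact: innerC. Qed.

Let GN p i u : G p (N i p) (d p u) = 0.
Proof. by case: N_normal => _ _; exact. Qed.

Let gE p u v : inner (fs_g S p) u v = G p (d p u) (d p v).
Proof. by case: S_induced => _ _ e _ _; exact: e. Qed.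

Let GDl p u v w : G p (u + v) w = G p u w + G p v w. Proof. exact: innerDl. Qed.
Let GBl p u v w : G p (u - v) w = G p u w - G p v w. Proof. exact: innerBl. Qed.
Let GBr p u v w : G p w (u - v) = G p w u - G p w v. Proof. exact: innerBr. Qed.
Let GZl p a u v : G p (a *: u) v = a * G p u v. Proof. exact: innerZl. Qed.

Let Gh X Y p v : G p (h X Y p) v
  = G p (D X (fun q => d q (Y q)) p) v - G p (d p (nabla X Y p)) v.
Proof. exact: GBl. Qed.

Let G0l p v : G p 0 v = 0. Proof. exact: inner0l. Qed.

Let vd X : vfield X -> vfield_along iota (fun q => d q (X q)).
Proof. exact: vfield_tmap. Qed.

Let torsion X Y p : vfield X -> vfield Y ->
  D X (fun q => d q (Y q)) p - D Y (fun q => d q (X q)) p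
  = d p (nabla X Y p) - d p (nabla Y X p).
Proof.
move=> hX hY; rewrite -dB; exact: (pullback_torsion sF D_induced p LCb nabla_LC hX hY).
Qed.

Let metric X V W p : vfield X -> vfield_along iota V -> vfield_along iota W ->
  dfun (fun q => G q (V q) (W q)) p (X p)
  = G p (D X V p) (W p) + G p (V p) (D X W p).
Proof. exact: (pullback_metric sF D_induced p hgb LCb). Qed.

Let metricM X Y Z p : vfield X -> vfield Y -> vfield Z ->
  dfun (fun q => G q (d q (Y q)) (d q (Z q))) p (X p)
  = G p (d p (nabla X Y p)) (d p (Z p)) + G p (d p (Y p)) (d p (nabla X Z p)).
Proof.
move=> hX hY hZ; have [_ _ met] := nabla_LC; rewrite -!gE -met //.
by under eq_fun do rewrite -gE.
Qed.

Local Notation T X Y p := (D X (fun q => d q (Y q) *m fb (iota q)) p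
               - D X (fun q => d q (Y q)) p *m fb (iota p)).

Let nearly_kahler X Y p : vfield X -> vfield Y -> T X Y p + T Y X p = 0.
Proof. exact: (pullback_nearly_kahler sF D_induced p Mb_wnK). Qed.

Let fE p u : d p (u *m fs_f S p)
  = d p u *m fb (iota p) + \sum_i eval_1form (fs_eta S i p) u *: N i p.
Proof.
have [_ eE _ fE' _] := S_induced.
by rewrite [LHS]fE'; congr (_ + _); apply: eq_bigr => i _; rewrite eE.
Qed.

Let skew p u v : G p (u *m fb (iota p)) v = - G p u (v *m fb (iota p)).
Proof. by have [[_ _ _ e _] _ _] := Mb_wnK; exact: e. Qed.

Let G_sum_N p (c : 'I_s -> R) u : G p (\sum_i c i *: N i p) (d p u) = 0.
Proof.
rewrite inner_suml big1 // => i _.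
by rewrite GZl GN mulr0.
Qed.

Let G_sumr p (c : 'I_s -> R) u v :
  G p u (v - \sum_i c i *: N i p) = G p u v - \sum_i c i * G p u (N i p).
Proof.
rewrite GBr [X in _ - X]inner_sumr; congr (_ - _).
by apply: eq_bigr => i _; exact: innerZr.
Qed.

Let G_suml p (u : 'I_s -> 'rV[R]_k) v :
  G p (\sum_i u i) v = \sum_i G p (u i) v.
Proof. exact: inner_suml. Qed.

Lemma inner_fs_xi p i u : inner (fs_g S p) (fs_xi S i p) u = eval_1form (fs_eta S i p) u.
Proof. by have [xE eE _ _ _] := S_induced; rewrite gE eE xE. Qed.


#[local] Opaque second_fundamental_form eval_1form.

Lemma second_fundamental_formC X Y p : vfield X -> vfield Y -> h X Y p = h Y X p.
Proof. by move=> hX hY; rewrite !hE; apply/esym/sub_swap/torsion. Qed.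

(* Koszul: the connection induced on M by D is metric and torsion-free. *)
Lemma second_fundamental_form_normal X Y Z p : vfield X -> vfield Y -> vfield Z ->
  G p (h X Y p) (d p (Z p)) = 0.
Proof.
move=> hX hY hZ.
(* [D] and [nabla] are metric for the same inner product, so their difference is skew in the last
   two arguments. *)
have K2 A B C : vfield A -> vfield B -> vfield C ->
    G p (h A B p) (d p (C p)) = - G p (h A C p) (d p (B p)).
  move=> hA hB hC.
  have e := etrans (esym (metricM p hA hB hC)) (metric p hA (vd hB) (vd hC)).
  apply: etrans (Gh A B p _) (etrans _ (esym (congr1 -%R (Gh A C p _)))).
  exact: sub_swapN e (GC _ _ _) (GC _ _ _).
have K1 A B C : vfield A -> vfield B -> G p (h A B p) (d p (C p)) = G p (h B A p) (d p (C p)).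
  by move=> hA hB; rewrite second_fundamental_formC.
exact: skew_sym_eq0 (K2 X Y Z hX hY hZ) (K1 X Z Y hX hZ)
  (K2 Z X Y hZ hX hY) (K1 Z Y X hZ hY)
  (K2 Y Z X hY hZ hX) (K1 Y X Z hY hX).
Qed.

Local Notation hN i X Y p := (G p (h X Y p) (N i p)).
Local Notation eta i X := (fun p => eval_1form (fs_eta S i p) (X p)).

(** Differentiate the vanishing product of [N i] with the tangent field [Z]. *)
Lemma weingarten i X Z p : vfield X -> vfield Z ->
  G p (D X (N i) p) (d p (Z p)) = - hN i X Z p.
Proof.
move=> hX hZ; have [sN _ _] := N_normal.
have := metric p hX (sN i) (vd hZ).
rewrite (_ : (fun q => _) = (fun=> 0)); last by apply/funext => q; exact: GN.
rewrite dfun_cst => /esym/eqP; rewrite addr_eq0 => /eqP ->.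
by rewrite Gh (GC p (d p (nabla X Z p))) GN subr0 GC.
Qed.

Hypothesis (sf : smooth_tensor11 (fs_f S)).
Hypothesis (seta : forall i, smooth_1form (fs_eta S i)).

Let aN Y i : vfield Y -> vfield_along iota (fun q => eta i Y q *: N i q).
Proof.
move=> hY; have [sN _ _] := N_normal.
exact: (vfield_alongZ sF (seta i hY) (sN i)).
Qed.

Let D_sum_N X Y p (r : seq 'I_s) : vfield X -> vfield Y ->
  D X (fun q => \sum_(i <- r) eta i Y q *: N i q) p
  = \sum_(i <- r) (dfun (eta i Y) p (X p) *: N i p + eta i Y p *: D X (N i) p).
Proof.
move=> hX hY; have [sN _ _] := N_normal; have [[_ _ _ DD DZ] _] := D_induced.
elim: r => [|i r IH].
  under eq_fun do rewrite big_nil.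
  have c0 : @smooth _ _ M (fun=> 0) := smooth_on_cst setT 0.
  have := DZ (fun=> 0) X (fun=> 0) c0 hX (vfield_along_cst0 sF) p.
  under eq_fun do rewrite scale0r.
  by rewrite dfun_cst !scale0r addr0 big_nil.
under eq_fun do rewrite big_cons.
rewrite (DD _ _ _ hX (aN i hY) (vfield_along_sum sF r (fun j => aN j hY))).
by rewrite big_cons IH (DZ _ _ _ (seta i hY) hX (sN i)).
Qed.

(** Substitute the formula for the induced [f] into both terms of the covariant derivative, and
    replace [nabla] by [D] minus [h]. *)
Lemma inner_cov_fs_f X Y Z p : vfield X -> vfield Y -> vfield Z ->
  inner (fs_g S p) (cov_tensor11 nabla (fs_f S) X Y p) (Z p)
  = G p (T X Y p) (d p (Z p))
    - \sum_i eta i Y p * hN i X Z p + \sum_i eta i Z p * hN i X Y p.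
Proof.
move=> hX hY hZ; have [[_ _ sfb _ _] _ _] := Mb_wnK.
have [[_ _ _ DD _] _] := D_induced.
have sfY := sf hY; have sfZ := sf hZ.
have eD : D X (fun q => d q (Y q *m fs_f S q)) p =
    D X (fun q => d q (Y q) *m fb (iota q)) p +
    \sum_i (dfun (eta i Y) p (X p) *: N i p + eta i Y p *: D X (N i) p).
  rewrite -D_sum_N // -(DD _ _ _ hX (vfield_along_tensor11 sF sfb (vd hY))
    (vfield_along_sum sF _ (fun j => aN j hY))).
  by congr (D X _ p); apply/funext => q; rewrite fE.
have nE A : d p (nabla X A p) = D X (fun q => d q (A q)) p - h X A p.
  by rewrite hE subKr.
(* Only the derivatives of the normals survive here: derivatives of the [eta] coefficients multiply
   normals, which are orthogonal to [Z]. *)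
have e1 : G p (d p (nabla X (fun q => Y q *m fs_f S q) p)) (d p (Z p))
    = G p (D X (fun q => d q (Y q) *m fb (iota q)) p) (d p (Z p))
      - \sum_i eta i Y p * hN i X Z p.
  have hn := second_fundamental_form_normal p hX sfY hZ.
  rewrite nE; apply: etrans (GBl _ _ _ _) (etrans (congr1 (fun x => _ - x) hn) _).
  rewrite subr0 eD; apply: etrans (GDl _ _ _ _) _.
  congr (_ + _); rewrite G_suml -sumrN; apply: eq_bigr => i _.
  by rewrite GDl !GZl GN mulr0 add0r (weingarten i p hX hZ) mulrN.
(* Skew-symmetry moves [fb] onto [Z]; as [h] is normal, it only meets the normal part of the
   image. *)
have e2 : G p (d p (nabla X Y p *m fs_f S p)) (d p (Z p))
    = G p (D X (fun q => d q (Y q)) p *m fb (iota p)) (d p (Z p))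
      - \sum_i eta i Z p * hN i X Y p.
  rewrite fE GDl G_sum_N addr0 nE mulmxBl GBl; congr (_ - _).
  rewrite skew.
  have -> : d p (Z p) *m fb (iota p)
      = d p (Z p *m fs_f S p) - \sum_i eta i Z p *: N i p by rewrite fE addrK.
  by rewrite G_sumr (second_fundamental_form_normal p hX hY sfZ) sub0r opprK.
rewrite gE /cov_tensor11 dB [LHS]GBl e1 e2.
apply: etrans (subrBAC _ _ _ _) (congr1 (fun x => x - _ + _) (esym (GBl _ _ _ _))).
Qed.

(** The ambient terms cancel by the nearly Kähler condition, and symmetry of [h] doubles the sum
    with [Z] in [eta]. *)
Lemma inner_sym_cov_fs_f X Y Z p : vfield X -> vfield Y -> vfield Z ->
  inner (fs_g S p) (cov_tensor11 nabla (fs_f S) X Y p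
                    + cov_tensor11 nabla (fs_f S) Y X p) (Z p)
  = 2 * (\sum_i eta i Z p * hN i X Y p)
    - \sum_i eta i Y p * hN i X Z p - \sum_i eta i X p * hN i Y Z p.
Proof.
move=> hX hY hZ; rewrite innerDl (inner_cov_fs_f p hX hY hZ) (inner_cov_fs_f p hY hX hZ).
have e := etrans (esym (GDl p _ _ _)) (etrans
  (congr1 (fun v => G p v (d p (Z p))) (nearly_kahler p hX hY)) (G0l p (d p (Z p)))).
apply: sum_sym_cov e _; apply: eq_bigr => i _.
exact: (congr1 (fun v => eta i Z p * G p v (N i p)) (second_fundamental_formC p hY hX)).
Qed.

End SecondFundamentalForm.

(** Test with a global field extending [u - v] and use positivity. *)
Lemma riemannian_eq (R : realType) m (M : manifold R m) (g : M -> 'M[R]_m) p u v :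
  riemannian_metric g ->
  (forall Z, vfield Z -> inner (g p) u (Z p) = inner (g p) v (Z p)) -> u = v.
Proof.
move=> [_ pos _] e; have [ext [hext extp _]] := tensorial_extension p (smooth_map_id M).
apply/eqP; rewrite -subr_eq0; apply: contraT => /(pos p).
by rewrite innerBl -[X in inner _ _ X - _]extp -[X in _ - inner _ _ X]extp e // subrr ltxx.
Qed.

(** * Symmetric cubic forms and the final algebra *)

Section CubicForm.
Context {R : comNzRingType} {s : nat}.
Implicit Types (a : 'I_s -> 'I_s -> 'I_s -> R) (x y z : 'I_s -> R).

(** The first factor stays outside the double sum, matching a sum of [eta i] times [h_i]. *)
Definition cubic a x y z := \sum_i x i * \sum_j \sum_k a i j k * y j * z k.

Lemma cubic_swapr a x y z : (forall i j k, a i j k = a i k j) ->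
  cubic a x y z = cubic a x z y.
Proof.
move=> aC; apply: eq_bigr => i _; congr (_ * _); rewrite exchange_big /=.
by apply: eq_bigr => j _; apply: eq_bigr => k _; rewrite aC mulrAC.
Qed.

Lemma cubic_swapl a x y z : (forall i j k, a i j k = a j i k) ->
  cubic a x y z = cubic a y x z.
Proof.
move=> aC; rewrite /cubic.
under eq_bigr do rewrite mulr_sumr.
under [RHS]eq_bigr do rewrite mulr_sumr.
rewrite exchange_big /=; apply: eq_bigr => j _; apply: eq_bigr => i _.
by rewrite !mulr_sumr; apply: eq_bigr => k _; rewrite aC; ring.
Qed.

Lemma sum_delta2 x y : \sum_j \sum_k (j == k)%:R * x j * y k = \sum_j x j * y j.
Proof.
apply: eq_bigr => j _; rewrite (bigD1 j) //= eqxx mul1r big1 ?addr0 // => k kj.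
by rewrite eq_sym (negbTE kj) !mul0r.
Qed.

End CubicForm.

(** Here [t] is the common cubic value, cancelled by [2 - 1 - 1 = 0]; [a], [b], [c] stand for the
    sums of the [eta i] at [X], [Y], [Z], and [u], [v], [w] for the products of [f]-images of the
    pairs [Y Z], [X Z], [X Y]. *)
Lemma nearly_S_identity (R : realFieldType) (a b c t u v w x y z : R) :
  x = c * w + t -> y = b * v + t -> z = a * u + t ->
  2 * x - y - z = 2 * w * c + a * - u + b * - v.
Proof. move=> -> -> ->; ring. Qed.

Lemma nearly_C_identity (R : realFieldType) (t x y z : R) :
  x = t -> y = t -> z = t -> 2 * x - y - z = 0.
Proof. move=> -> -> ->; ring. Qed.

Theorem theorem4 (R : realType) (n s : nat)
    (n_gt0 : (0 < n)%N) (s_gt0 : (0 < s)%N)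
    (* the ambient weak nearly Kaehler manifold *)
    (Mb : manifold R (2 * n + s + s))
    (fb gb : Mb -> 'M[R]_(2 * n + s + s))
    (nablab : (Mb -> 'rV[R]_(2 * n + s + s)) -> (Mb -> 'rV[R]_(2 * n + s + s)) ->
              Mb -> 'rV[R]_(2 * n + s + s))
    (Mb_wnK : weak_nearly_kahler fb gb nablab)
    (* the submanifold and its normals *)
    (M : manifold R (2 * n + s)) (iota : M -> Mb)
    (iota_sub : submanifold iota)
    (N : 'I_s -> M -> 'rV[R]_(2 * n + s + s))
    (N_normal : orthonormal_normals iota gb N)
    (fN_normal : forall p i j,
       inner (gb (iota p)) (N i p *m fb (iota p)) (N j p) = 0)
    (* the induced weak metric f-structure *)
    (S : fstructure M s)
    (S_induced : induced_fstructure iota fb gb N S)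
    (S_wmf : weak_metric_f S)
    (* the Levi-Civita connection of M, and nablab along M *)
    (nabla : (M -> 'rV[R]_(2 * n + s)) -> (M -> 'rV[R]_(2 * n + s)) ->
             M -> 'rV[R]_(2 * n + s))
    (nabla_LC : levi_civita (fs_g S) nabla)
    (D : (M -> 'rV[R]_(2 * n + s)) -> (M -> 'rV[R]_(2 * n + s + s)) ->
         M -> 'rV[R]_(2 * n + s + s))
    (D_induced : induced_connection iota nablab D) :
  let xi := fs_xi S in
  let eta i X (p : M) := eval_1form (fs_eta S i p) (X p) in
  let hN i X Y (p : M) :=
    inner (gb (iota p)) (second_fundamental_form iota nabla D X Y p) (N i p) in
  (forall i j k p, hN i (xi j) (xi k) p = hN j (xi i) (xi k) p) ->
  ((forall i X Y, vfield X -> vfield Y -> forall p,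
      hN i X Y p
      = inner (fs_g S p) (X p *m fs_Q S p) (Y p)
        + \sum_j \sum_k (hN i (xi j) (xi k) p - (j == k)%:R)
                        * eta j X p * eta k Y p) ->
   weak_nearly_S S nabla)
  /\
  ((forall i X Y, vfield X -> vfield Y -> forall p,
      hN i X Y p
      = \sum_j \sum_k hN i (xi j) (xi k) p * eta j X p * eta k Y p) ->
   weak_nearly_C S nabla).
Proof.
move=> xi eta hN hsym.
have [[_ _ hg] [sf _ skewf] [_ _ symQ] [sxi seta _] [_ _ _ gff]] := S_wmf.
have key X Y Z p hX hY hZ := inner_sym_cov_fs_f Mb_wnK iota_sub N_normal S_induced
  nabla_LC D_induced sf seta (X := X) (Y := Y) (Z := Z) p hX hY hZ.
(* Symmetry of [h] exchanges the last two indices and [hsym] the first two, so the coefficients are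
   totally symmetric. *)
have hNC p i j k : hN i (xi j) (xi k) p = hN i (xi k) (xi j) p.
  exact: (congr1 (fun v => inner (gb (iota p)) v (N i p))
    (second_fundamental_formC Mb_wnK iota_sub nabla_LC D_induced p (sxi j) (sxi k))).
pose a p i j k := hN i (xi j) (xi k) p.
pose e p X i := eta i X p.
have cl p X Y Z : cubic (a p) (e p X) (e p Y) (e p Z) = cubic (a p) (e p Y) (e p X) (e p Z).
  by apply: cubic_swapl => i j k; exact: hsym.
have cr p X Y Z : cubic (a p) (e p X) (e p Y) (e p Z) = cubic (a p) (e p X) (e p Z) (e p Y).
  by apply: cubic_swapr => i j k; exact: hNC.
have cyc p X Y Z : cubic (a p) (e p X) (e p Y) (e p Z) = cubic (a p) (e p Z) (e p X) (e p Y).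
  exact: etrans (cr _ _ _ _) (cl _ _ _ _).
(* In both cases the identity is paired with an arbitrary field [Z], and its left side is replaced
   through [key]. *)
split=> H; (split; [exact: S_wmf|exact: nabla_LC|]) => X Y hX hY p;
  apply: (riemannian_eq (p := p) hg) => Z hZ; apply: etrans (key X Y Z p hX hY hZ) _.
- pose q A B := inner (fs_g S p) (A p *m fs_f S p) (B p *m fs_f S p).
  (* The Kronecker part of the hypothesis combines with the [Q] term into [q A B], by the
     compatibility of [f] with the metric. *)
  have hE i A B : vfield A -> vfield B ->
      hN i A B p = q A B + \sum_j \sum_k a p i j k * e p A j * e p B k.
    move=> hA hB; rewrite (H i A B hA hB p) /q gff symQ -addrA; congr (_ + _).
    under eq_bigr do under eq_bigr do rewrite !mulrBl.
    under eq_bigr do rewrite sumrB.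
    rewrite sumrB sum_delta2 addrC; congr (_ + _).
  have sE A B C : vfield A -> vfield B ->
      \sum_i e p C i * hN i A B p
      = (\sum_i e p C i) * q A B + cubic (a p) (e p C) (e p A) (e p B).
    move=> hA hB; rewrite mulr_suml -big_split /=; apply: eq_bigr => i _.
    by rewrite hE // mulrDr.
  have xiE : inner (fs_g S p) (\sum_i xi i p) (Z p) = \sum_i e p Z i.
    rewrite inner_suml; apply: eq_bigr => i _; exact: (inner_fs_xi S_induced).
  have ffE A B : inner (fs_g S p) (A p *m fs_f S p *m fs_f S p) (B p) = - q A B.
    exact: skewf.
  rewrite !innerDl !innerZl xiE !ffE.
  apply: nearly_S_identity (sE _ _ Z hX hY) _ _.
  + exact: etrans (sE _ _ Y hX hZ) (congr1 (fun t => _ + t)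
      (etrans (cyc _ _ _ _) (cr _ _ _ _))).
  + exact: etrans (sE _ _ X hY hZ) (congr1 (fun t => _ + t) (cyc _ _ _ _)).
- have sE A B C : vfield A -> vfield B ->
      \sum_i e p C i * hN i A B p = cubic (a p) (e p C) (e p A) (e p B).
    by move=> hA hB; apply: eq_bigr => i _; rewrite (H i A B hA hB p).
  rewrite inner0l.
  apply: nearly_C_identity (sE _ _ Z hX hY) _ _.
  + exact: etrans (sE _ _ Y hX hZ) (etrans (cyc _ _ _ _) (cr _ _ _ _)).
  + exact: etrans (sE _ _ X hY hZ) (cyc _ _ _ _).
Qed.
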